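(* Let $V$ be a finite dimensional real inner product space with norm $\|\cdot\|$, and let $\mu=[m,D,M]$ be an infinitely divisible probability measure on $V$. Put $W=\operatorname{ssupp}(\mu)$ and $W_0=W\setminus\{0\}$, and let $T$ be an invertible linear operator on $W$ such that $T(\mathbb{A}(\mu)|_W)T^{-1}$ is a subgroup of the group of linear isometries of $W$, where $\mathbb{A}(\mu)|_W=\{S|_W : S\in\mathbb{A}(\mu)\}$. Then the vector \[ h' = -\bigg(m+\int_{W_0}\frac{\|u\|^2-\|Tu\|^2}{(1+\|Tu\|^2)(1+\|u\|^2)}\,u\,M(du)\bigg) \] satisfies $\mu*\delta(h')=S(\mu*\delta(h'))$ for every $S\in\mathbb{A}(\mu)$.
   Context: For a linear operator $S$ and a probability measure $\mu$ on $V$, $S\mu(E)=\mu(S^{-1}(E))$ is the image measure; $*$ is convolution; $\delta(h)$ is the point mass at $h$. A linear operator $S\in\operatorname{End}V$ is a symmetry of $\mu$ if $\mu=S\mu*\delta(h)$ for some $h\in V$; $\mathbb{A}(\mu)$ is the set of all symmetries of $\mu$. The supporting subspace $\operatorname{ssupp}(\mu)$ is the unique linear subspace $W$ of $V$ such that the smallest affine subspace of $V$ on which $\mu$ is concentrated has the form $W+h$ for some $h\in V$. Every $S\in\mathbb{A}(\mu)$ maps $W=\operatorname{ssupp}(\mu)$ into itself, so $S|_W$ is an operator on $W$; an invertible $T$ as in the claim always exists. The notation $\mu=[m,D,M]$ means that $\mu$ is infinitely divisible with characteristic function \[ \hat\mu(u)=\exp\Big\{i(m,u)-\tfrac12(Du,u)+\int_{V_0}\Big(e^{i(v,u)}-1-\frac{i(v,u)}{1+\|v\|^2}\Big)M(dv)\Big\},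 \] where $m\in V$, $D$ is a non-negative linear operator on $V$, $V_0=V\setminus\{0\}$, and $M$ (the Lévy spectral measure) is a Borel measure on $V_0$ with $\int_{V_0}\|v\|^2/(1+\|v\|^2)\,M(dv)<\infty$. *)

(* Defs.v *)
From HB Require Import structures.
From mathcomp Require Import all_boot all_order all_algebra sesquilinear.
From mathcomp Require Import complex.
From mathcomp Require Import all_classical all_reals all_analysis.

Set Implicit Arguments.
Unset Strict Implicit.
Unset Printing Implicit Defensive.

Import Order.TTheory GRing.Theory Num.Theory.
Import numFieldNormedType.Exports.

Local Open Scope classical_set_scope.
Local Open Scope ring_scope.
Local Open Scope complex_scope.

(* Finite dimensional real inner product spaces: the norm (hence the topology)
   of V is the one induced by the inner product. *)
HB.mixin Record isInnerProductSpace (R : realType) V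
    & NormedModule R V & Vector R V := {
  inner : {dot V for idfun} ;
  norm_innerE : forall v : V, `|v| = Num.sqrt (inner v v)
}.

#[short(type="innerProductSpaceType")]
HB.structure Definition InnerProductSpace (R : realType) :=
  {V of NormedModule R V & Vector R V & isInnerProductSpace R V}.

Notation "''(' u , v ')'" := (inner (u : InnerProductSpace.sort _) v)
  (at level 0, format "''(' u ,  v ')'") : ring_scope.

Notation borel V := (g_sigma_algebraType (@open V)).

(* Measures on V are handled as set functions; only their values on Borel sets
   are meaningful. *)
Section Measures.
Context {R : realType} {V : innerProductSpaceType R}.
Implicit Types (mu nu : set (borel V) -> \bar R).

Definition same_measure mu nu := forall E, measurable E -> mu E = nu E.

Definition image_measure (S : 'End(V)) mu : set (borel V) -> \bar R :=
  pushforward mu (S : borel V -> borel V).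

Definition convolution mu nu : set (borel V) -> \bar R :=
  pushforward (mu \x nu)%E
    (fun p : borel V * borel V => (p.1 : V) + (p.2 : V) : borel V).

Definition point_mass (h : V) : set (borel V) -> \bar R := \d_(h : borel V).

Definition convolution_pow (n : nat) nu := iter n (convolution nu) (point_mass 0).

Definition is_symmetry mu (S : 'End(V)) :=
  exists h : V, same_measure mu (convolution (image_measure S mu) (point_mass h)).

Definition symmetries mu : set 'End(V) := [set S | is_symmetry mu S].

Definition infinitely_divisible mu :=
  forall n, (0 < n)%N ->
    exists nu : probability (borel V) R, same_measure mu (convolution_pow n nu).

Definition affine_subspace (W : {vspace V}) (h : V) : set V :=
  [set w + h | w in [set` W]].

Definition concentrated_on mu (A : set V) := mu A = 1%E.

(* W = ssupp(mu) *)
Definition is_ssupp mu (W : {vspace V}) :=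
  exists h : V, concentrated_on mu (affine_subspace W h) /\
    forall (W' : {vspace V}) (h' : V),
      concentrated_on mu (affine_subspace W' h') ->
      affine_subspace W h `<=` affine_subspace W' h'.

End Measures.

Section LevyKhintchine.
Context {R : realType} {V : innerProductSpaceType R}.
Implicit Types (mu M : {measure set (borel V) -> \bar R}).

Definition cexp (z : R[i]) : R[i] :=
  let: a +i* b := z in (expR a * cos b) +i* (expR a * sin b).

Definition cintegral mu (D : set V) (f : V -> R[i]) : R[i] :=
  (\int[mu]_(v in D) complex.Re (f v)) +i* (\int[mu]_(v in D) complex.Im (f v)).

Definition charfun mu (u : V) : R[i] :=
  cintegral mu setT (fun v => cexp ('i%C * '(v, u)%:C)).

Definition levy_exponent (m : V) (D : 'End(V)) M (u : V) : R[i] :=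
  'i%C * '(m, u)%:C - 2^-1 * '(D u, u)%:C
  + cintegral M [set v | v != 0] (fun v =>
      cexp ('i%C * '(v, u)%:C) - 1 - 'i%C * '(v, u)%:C / (1 + `|v| ^+ 2)%:C).

(* mu = [m, D, M].  A Borel measure M on V \ {0} is encoded as a Borel measure
   on V that does not charge 0. *)
Definition is_levy_triple mu (m : V) (D : 'End(V)) M :=
  [/\ infinitely_divisible mu,
      forall u : V, 0 <= '(D u, u),
      M [set 0 : V] = 0%E,
      (\int[M]_(v in [set v : V | v != 0%R])
         (`|v : V| ^+ 2 / (1 + `|v : V| ^+ 2))%:E < +oo)%E
    & forall u : V, charfun mu u = cexp (levy_exponent m D M u)].

(* Integral of a V-valued function, computed in coordinates; for integrable f
   it does not depend on the basis. *)
Definition vintegral mu (D : set V) (f : V -> V) : V :=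
  \sum_(i < \dim {:V})
    (\int[mu]_(v in D) coord (vbasis {:V}) i (f v)) *: (vbasis {:V})`_i.

End LevyKhintchine.

Section OperatorsOnSubspace.
Context {R : realType} {V : innerProductSpaceType R} (W : {vspace V}).
Implicit Types (A : set 'End(V)) (G : set 'End(subvs_of W)).

(* {S|_W : S in A} *)
Definition restrictions A : set 'End(subvs_of W) :=
  [set B | exists2 S, A S & forall w, vsval (B w) = S (vsval w)].

Definition linear_isometries : set 'End(subvs_of W) :=
  [set g | forall w, `|vsval (g w)| = `|vsval w|].

(* Isometries of W being bijective, g^-1 is a two-sided inverse here. *)
Definition isometry_subgroup G :=
  [/\ G `<=` linear_isometries,
      G \1%VF,
      forall g g', G g -> G g' -> G (g \o g')%VF
    & forall g, G g -> G (g^-1)%VF].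

Definition conjugate_by (T : 'End(subvs_of W)) G : set 'End(subvs_of W) :=
  [set (T \o B \o T^-1)%VF | B in G].

(* The integrand below is only evaluated at u \in W, where vsproj W u is u
   seen as an element of W. *)
Definition center_vector (T : 'End(subvs_of W)) (m : V)
    (M : {measure set (borel V) -> \bar R}) : V :=
  let normT (u : V) := `|vsval (T (vsproj W u))| in
  - (m + vintegral M [set u | u \in W /\ u != 0] (fun u =>
       ((`|u| ^+ 2 - normT u ^+ 2)
          / ((1 + normT u ^+ 2) * (1 + `|u| ^+ 2))) *: u)).

End OperatorsOnSubspace.

Arguments restrictions {R V} W A.
Arguments linear_isometries {R V} W.

(* Main.v *)
Require Import Defs.
From HB Require Import structures.
From mathcomp Require Import all_boot all_order all_algebra sesquilinear.
From mathcomp Require Import complex ring lra.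
From mathcomp Require Import all_classical all_reals all_analysis.
From mathcomp Require Import measurable_realfun.

Set Implicit Arguments.
Unset Strict Implicit.
Unset Printing Implicit Defensive.

Import Order.TTheory GRing.Theory Num.Theory.
Import numFieldNormedType.Exports.

Local Open Scope classical_set_scope.
Local Open Scope ring_scope.

(** Let S be a symmetry, mu = S mu * delta(h). Minimality of W gives S W <= W,
    and |charfun mu| = 1 on the orthogonal complement of W shows that M lives on
    W. Since S preserves |T u| on W, the Levy exponent is recentred with the
    truncation function rho(v) = 1 / (1 + |T v|^2), which replaces m by -h'.
    Comparing imaginary parts of the exponents (the ambiguity modulo 2 pi is
    removed by continuity) yields, for l = S h' - h' - h and every u,
      (l, u) = int_W (G_u(S v) - G_u(v)) M(dv),
      G_u(v) = sin (v, u) - (v, u) rho(v).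
    No uniqueness theorem for Levy measures is needed to conclude that l = 0:
    if |T v|^2 = sum_j (v, w_j)^2, then (v, w_k) rho(v) is a limit of finite sums
    sum_i c_i sin (v, y_i) with sum_i c_i y_i tending to w_k, obtained from the
    Neumann series of (1 - Laplacian)^-1 on lattices of mesh 1 / N. Replacing
    u by these combinations, dominated convergence gives (l, w_k) = 0. *)

(** * Trigonometric approximation of x_k / (1 + |x|^2) *)

Section TrigonometricBounds.
Context {R : realType}.
Implicit Types x : R.

Lemma normr_sin_le x : `|sin x| <= `|x|.
Proof.
wlog x0 : x / 0 < x.
  move=> H; have [/H//|x0|<-] := ltgtP 0 x; last by rewrite sin0 normr0.
  by have := H (- x); rewrite sinN !normrN oppr_gt0 => /(_ x0).
have [c _] := @MVT R sin cos 0 x x0 (fun y _ => is_derive_sin y)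
  (continuous_subspaceT (@continuous_sin R)).
rewrite sin0 !subr0 => ->; rewrite normrM.
by rewrite ler_piMl// cos_max.
Qed.

Lemma one_sub_cosE x : 1 - cos x = 2 * sin (x / 2) ^+ 2.
Proof.
have -> : cos x = cos (x / 2 *+ 2) by congr cos; rewrite mulr2n; lra.
rewrite cos_mulr2n cos2sin2; lra.
Qed.

Lemma one_sub_cos_le_sqr x : 1 - cos x <= x ^+ 2 / 2.
Proof.
rewrite one_sub_cosE.
have : `|sin (x / 2)| ^+ 2 <= `|x / 2| ^+ 2.
  by rewrite lerXn2r ?nnegrE// normr_sin_le.
rewrite !real_normK ?num_real// exprMn; lra.
Qed.

Lemma one_sub_cos_le_norm x : 1 - cos x <= `|x|.
Proof.
rewrite one_sub_cosE.
have : `|sin (x / 2)| <= `|x / 2| := normr_sin_le _.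
have : `|sin (x / 2)| <= 1 := sin_max _.
rewrite -[sin _ ^+ 2]real_normK ?num_real// normrM (ger0_norm (_ : 0 <= 2^-1)) ?invr_ge0//.
have : 0 <= `|sin (x / 2)| by [].
nra.
Qed.

(** The mean value theorem for [sin y - y] gives a factor [1 - cos c] with [c] between 0 and [x],
    and [one_sub_cos_le_norm] bounds that factor linearly. *)
Lemma normr_sin_sub_le x : `|sin x - x| <= x ^+ 2.
Proof.
wlog x0 : x / 0 < x.
  move=> H; have [/H//|x0|<-] := ltgtP 0 x; last by rewrite sin0 subrr normr0 expr0n.
  have := H (- x); rewrite sinN sqrrN -opprD normrN oppr_gt0; exact.
have [c /[!in_itv]/= /andP[c0 cx]] := @MVT R (sin \- id) (cos \- cst 1) 0 x x0
  (fun y _ => is_deriveB (is_derive_sin y) (is_derive_id y 1))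
  (continuous_subspaceT (fun y => cvgB (@continuous_sin R y) (@cvg_id _ _))).
rewrite /= sin0 subrr !subr0 => ->; rewrite normrM expr2 -normrN opprB.
rewrite [`|1 - _|]ger0_norm ?subr_ge0 ?cos_le1// (gtr0_norm x0).
apply: ler_wpM2r; first exact: ltW.
apply: le_trans (one_sub_cos_le_norm c) _.
by rewrite gtr0_norm// ltW.
Qed.

End TrigonometricBounds.

(** * Truncated Neumann series of the scalar resolvent *)

Section TruncatedResolvent.
Context {R : realType}.
Variables (K : nat) (q : R).

(* Partial sum of the Neumann series of (1 + s)^-1 = q^-1 (1 - b)^-1,
   where b = (q - 1 - s) / q. *)
Definition trunc_resolvent (s : R) : R :=
  q^-1 * \sum_(i < K) ((q - 1 - s) / q) ^+ i.

(** Since [1 + s = q * (1 - b)] for the ratio [b = (q - 1 - s) / q], the geometric sum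
    telescopes. *)
Lemma trunc_resolventE (s : R) : 1 <= q ->
  (1 + s) * trunc_resolvent s = 1 - ((q - 1 - s) / q) ^+ K.
Proof.
move=> q1; have q0 : 0 < q by exact: lt_le_trans q1.
have -> : 1 - ((q - 1 - s) / q) ^+ K = 1 ^+ K - ((q - 1 - s) / q) ^+ K by rewrite expr1n.
rewrite subrXX mulrA.
congr (_ * _); first by field; rewrite gt_eqF.
by apply: eq_bigr => i _; rewrite expr1n mul1r.
Qed.

(** The admissible interval for [s] is symmetric about [q - 1], so the ratio is largest in modulus
    at its endpoints. *)
Lemma resolvent_ratio_le (s : R) : 1 <= q -> 0 <= s -> s <= 2 * (q - 1) ->
  `|(q - 1 - s) / q| <= (q - 1) / q.
Proof.
move=> q1 s0 sq; have q0 : 0 < q by exact: lt_le_trans q1.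
rewrite normrM (gtr0_norm (x := q^-1)) ?invr_gt0// ler_pM2r ?invr_gt0//.
rewrite ler_norml; apply/andP; split; lra.
Qed.

Lemma resolvent_ratio0_lt1 : 1 <= q -> (q - 1) / q < 1.
Proof. move=> q1; have q0 : 0 < q by exact: lt_le_trans q1.
rewrite ltr_pdivrMr//; lra. Qed.

Lemma resolvent_ratio_le1 (s : R) : 1 <= q -> 0 <= s -> s <= 2 * (q - 1) ->
  `|(q - 1 - s) / q| <= 1.
Proof.
move=> q1 s0 sq; have q0 : 0 < q by exact: lt_le_trans q1.
exact: le_trans (resolvent_ratio_le q1 s0 sq) (ltW (resolvent_ratio0_lt1 q1)). Qed.

Lemma trunc_resolvent_ge0 (s : R) : 1 <= q -> 0 <= s -> s <= 2 * (q - 1) ->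
  0 <= trunc_resolvent s.
Proof.
move=> q1 s0 sq; have q0 : 0 < q by exact: lt_le_trans q1.
have s1 : 0 < 1 + s by lra.
rewrite -(pmulr_rge0 _ s1) trunc_resolventE// subr_ge0.
apply: le_trans (ler_norm _) _; rewrite normrX.
by rewrite exprn_ile1// resolvent_ratio_le1.
Qed.

Lemma trunc_resolvent_le (s : R) : 1 <= q -> 0 <= s -> s <= 2 * (q - 1) ->
  (1 + s) * trunc_resolvent s <= 2.
Proof.
move=> q1 s0 sq; have q0 : 0 < q by exact: lt_le_trans q1.
rewrite trunc_resolventE//.
have : `|((q - 1 - s) / q) ^+ K| <= 1.
  by rewrite normrX exprn_ile1// resolvent_ratio_le1.
rewrite ler_norml => /andP[]; lra.
Qed.

(** A Lipschitz bound at 0, uniform in [K] and [q]. The constant 3 is 1 + 2: by [trunc_resolventE]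
    the powers differ by at most [s], and the extra term [s * trunc_resolvent s] is at most
    [2 * s]. *)
Lemma trunc_resolvent_sub0_le (s : R) : 1 <= q -> 0 <= s -> s <= 2 * (q - 1) ->
  `|trunc_resolvent s - trunc_resolvent 0| <= 3 * s.
Proof.
move=> q1 s0 sq; have q0 : 0 < q by exact: lt_le_trans q1.
(* Induction on [K]: one step turns the bound [s] into [a * s + s / q], which is [s] again because
   [a = 1 - q^-1]. *)
have H : `|((q - 1) / q) ^+ K - ((q - 1 - s) / q) ^+ K| <= s.
  elim: K => [|k IH]; first by rewrite !expr0 subrr normr0.
  set a := (q - 1) / q in IH *; set b := (q - 1 - s) / q in IH *.
  have -> : a ^+ k.+1 - b ^+ k.+1 = a * (a ^+ k - b ^+ k) + (a - b) * b ^+ k.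
    rewrite !exprS; ring.
  apply: le_trans (ler_normD _ _) _; rewrite normrM [X in _ + X]normrM.
  have -> : a - b = s / q by rewrite /a /b; field; rewrite gt_eqF.
  have a0 : 0 <= a by rewrite /a divr_ge0 ?(ltW q0)//; lra.
  rewrite (ger0_norm a0) (ger0_norm (divr_ge0 s0 (ltW q0))).
  apply: (@le_trans _ _ (a * s + s / q)).
    rewrite lerD ?ler_wpM2l// ler_piMr ?divr_ge0 ?(ltW q0)//.
    by rewrite normrX exprn_ile1// resolvent_ratio_le1.
  by rewrite le_eqVlt; apply/orP; left; apply/eqP; rewrite /a; field; rewrite gt_eqF.
set u := trunc_resolvent s; set w := trunc_resolvent 0.
have u0 : 0 <= u := trunc_resolvent_ge0 q1 s0 sq.
have := trunc_resolvent_le q1 s0 sq; rewrite -/u => u2.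
have : `|w - (1 + s) * u| <= s.
  move: H; rewrite /u trunc_resolventE// .
  have := trunc_resolventE 0 q1; rewrite addr0 mul1r subr0 -/w => ->.
  set a := _ ^+ K; set b := _ ^+ K => abs.
  have -> : 1 - a - (1 - b) = b - a by ring.
  by rewrite distrC.
have : s * u <= 2 * s by nra.
have : 0 <= s * u by rewrite mulr_ge0.
rewrite !ler_norml => ? ? /andP[? ?]; apply/andP; split; nra.
Qed.

End TruncatedResolvent.

(** At [s = 0] the truncated resolvent with [K.+1] terms is at most 1, while each of its terms is at
    least [q^-1 * a ^+ K], where [a = (q - 1) / q]. *)
Lemma trunc_resolvent_tail {R : realType} (K : nat) (q : R) : 1 <= q ->
  ((q - 1) / q) ^+ K <= q / K.+1%:R.
Proof.
move=> q1; have q0 : 0 < q by exact: lt_le_trans q1.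
set a := _ / q.
have a0 : 0 <= a by rewrite /a divr_ge0 ?(ltW q0)//; lra.
have a1 : a <= 1 by exact/ltW/resolvent_ratio0_lt1.
have := @trunc_resolventE _ K.+1 q 0 q1.
rewrite addr0 mul1r subr0 -/a /trunc_resolvent subr0 -/a => H.
rewrite ler_pdivlMr// -(ler_pM2l (x := q^-1)) ?invr_gt0// mulVf ?gt_eqF//.
have H1 : q^-1 * \sum_(i < K.+1) a ^+ i <= 1.
  by rewrite H lerBlDr lerDl exprn_ge0.
apply: le_trans H1; rewrite ler_pM2l ?invr_gt0//.
rewrite mulr_natr -[X in _ *+ X]card_ord -sumr_const.
apply: ler_sum => i _; rewrite ler_wiXn2l//.
by rewrite -ltnS.
Qed.

(** * The resolvent of the lattice Laplacian and a uniform error bound *)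

Section LatticeWalkResolvent.
Context {R : realType} (n : nat).
Implicit Types (x : 'I_n -> R) (k : 'I_n) (N : nat).

(* For the lattice Laplacian L of mesh 1 / (N + 1), 1 - L = walk_const - P where
   P is a multiple of the walk operator; the Neumann series below thus consists
   of transforms of finitely supported measures. *)
Definition walk_const N : R := 1 + 2 * (n * N.+1 ^ 2)%:R.
(** This is [N.+1] times [walk_const N], so that [trunc_resolvent_tail] yields a remainder of at
    most [N.+1%:R^-1]. *)
Definition walk_length N : nat := N.+1 * (1 + 2 * (n * N.+1 ^ 2)).
(** The Fourier symbol of minus the second-difference Laplacian of mesh [1 / (N + 1)]. *)
Definition walk_symbol N x : R :=
  \sum_j (2 * N.+1%:R ^+ 2 * (1 - cos (x j / N.+1%:R))).
Definition walk_resolvent N : R -> R :=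
  trunc_resolvent (walk_length N).+1 (walk_const N).

Let sqnorm x := \sum_j x j ^+ 2.

(** The factor [walk_resolvent N 0] is the first moment, in direction [k], of the signed measure
    whose sine transform is the first term. The linear parts at the origin therefore cancel. *)
Definition walk_error k N x : R :=
  N.+1%:R * sin (x k / N.+1%:R) * walk_resolvent N (walk_symbol N x)
  - walk_resolvent N 0 * (x k / (1 + sqnorm x)).

Lemma walk_const_ge1 N : 1 <= walk_const N.
Proof. by rewrite /walk_const lerDl mulr_ge0. Qed.

Lemma walk_symbol_ge0 N x : 0 <= walk_symbol N x.
Proof.
by apply: sumr_ge0 => j _; rewrite mulr_ge0 ?mulr_ge0 ?exprn_ge0// subr_ge0 cos_le1.
Qed.

Lemma walk_symbol_le_const N x : walk_symbol N x <= 2 * (walk_const N - 1).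
Proof.
have -> : 2 * (walk_const N - 1) = \sum_(j < n) (2 * N.+1%:R ^+ 2 * 2 : R).
  rewrite sumr_const card_ord -[RHS]mulr_natl /walk_const natrM natrX; ring.
apply: ler_sum => j _; apply: ler_wpM2l; first by rewrite mulr_ge0 ?exprn_ge0.
have := cos_geN1 (x j / N.+1%:R); lra.
Qed.

Lemma walk_symbol_le N x : walk_symbol N x <= sqnorm x.
Proof.
apply: ler_sum => j _.
have := one_sub_cos_le_sqr (x j / N.+1%:R); rewrite exprMn exprVn => H.
have : 0 < N.+1%:R :> R by []; set p := N.+1%:R in H * => p0.
apply: le_trans (ler_wpM2l _ H) _; first by rewrite mulr_ge0 ?exprn_ge0// ltW.
by rewrite le_eqVlt; apply/orP; left; apply/eqP; field; rewrite gt_eqF.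
Qed.

(** From [sin^2 = (1 - cos) (1 + cos)] and [1 + cos <= 2]. It lets the decay of the resolvent in the
    symbol absorb the sine factor for large [x]. *)
Lemma sqr_sin_le_walk_symbol k N x :
  (N.+1%:R * sin (x k / N.+1%:R)) ^+ 2 <= walk_symbol N x.
Proof.
rewrite /walk_symbol (bigD1 k)//=; apply: (@le_trans _ _
    (2 * N.+1%:R ^+ 2 * (1 - cos (x k / N.+1%:R)))); last first.
  rewrite lerDl; apply: sumr_ge0 => j _.
  by rewrite mulr_ge0 ?mulr_ge0 ?exprn_ge0// subr_ge0 cos_le1.
rewrite exprMn sin2cos2 [2 * _]mulrC -[leRHS]mulrA ler_wpM2l ?exprn_ge0//.
have := cos_le1 (x k / N.+1%:R); have := cos_geN1 (x k / N.+1%:R); nra.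
Qed.

Lemma sqr_coord_le k x : x k ^+ 2 <= sqnorm x.
Proof.
rewrite /sqnorm (bigD1 k)//= lerDl; apply: sumr_ge0 => j _.
exact: sqr_ge0.
Qed.

Lemma walk_sin_sub_le k N x : `|N.+1%:R * sin (x k / N.+1%:R) - x k| <= x k ^+ 2 / N.+1%:R.
Proof.
have N0 : (N.+1%:R : R) != 0 by rewrite pnatr_eq0.
have -> : N.+1%:R * sin (x k / N.+1%:R) - x k =
    N.+1%:R * (sin (x k / N.+1%:R) - x k / N.+1%:R) by field.
rewrite normrM ger0_norm//.
apply: le_trans (ler_wpM2l _ (normr_sin_sub_le _)) _ => //.
by rewrite le_eqVlt; apply/orP; left; apply/eqP; field.
Qed.

(** The bound is uniform in [N], as dominated convergence requires. Near the origin the first-order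
    terms cancel; far away each of the two terms is bounded separately. The constant 20 is
    generous. *)
Lemma walk_error_bound k N x :
  `|walk_error k N x| <= 20 * (sqnorm x / (1 + sqnorm x)).
Proof.
have := walk_const_ge1 N; have := walk_symbol_ge0 N x.
have := walk_symbol_le_const N x.
set q := walk_const N; set s := walk_symbol N x => sq s0 q1.
have st := walk_symbol_le N x; rewrite -/s in st.
have := @sqr_sin_le_walk_symbol k N x; rewrite -/s.
have := @walk_sin_sub_le k N x.
have := sqr_coord_le k x.
rewrite /walk_error -/s.
set D := _ * sin _; set X := x k; set t := sqnorm x in st *.
move=> xt DX Ds.
have q00 : 0 <= 2 * (q - 1) by rewrite mulr_ge0// subr_ge0.
have := @trunc_resolvent_ge0 _ (walk_length N).+1 _ _ q1 s0 sq.
have := @trunc_resolvent_le _ (walk_length N).+1 _ _ q1 s0 sq.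
have := @trunc_resolvent_sub0_le _ (walk_length N).+1 _ _ q1 s0 sq.
have := @trunc_resolvent_ge0 _ (walk_length N).+1 _ _ q1 (lexx _) q00.
have := @trunc_resolvent_le _ (walk_length N).+1 _ _ q1 (lexx _) q00.
rewrite addr0 mul1r -/(walk_resolvent N).
move: (walk_resolvent N s) (walk_resolvent N 0) => r r0 r02 r00 rr0 r2 r_ge0.
have t0 : 0 <= t by apply: le_trans xt; exact: sqr_ge0.
have t1 : 0 < 1 + t by rewrite ltr_wpDr.
have DX' : `|D - X| <= X ^+ 2.
  apply: le_trans DX _; rewrite ler_pdivrMr// ler_peMr ?sqr_ge0//.
  by rewrite ler1n.
have -> : D * r - r0 * (X / (1 + t)) = (D * r * (1 + t) - r0 * X) / (1 + t).
  by field; rewrite gt_eqF.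
rewrite normrM (gtr0_norm (x := (1 + t)^-1)) ?invr_gt0// mulrA ler_pM2r ?invr_gt0//.
have aX : `|X| ^+ 2 <= t by rewrite real_normK ?num_real.
have aD : `|D| ^+ 2 <= s by rewrite real_normK ?num_real.
have aX0 : 0 <= `|X| by [].
have aD0 : 0 <= `|D| by [].
have [tl|tg] := lerP t 1.
  (* Three quadratic errors: the sine against its argument, the resolvent against its value at 0,
     and the denominator [1 + t] against 1. *)
  have -> : D * r * (1 + t) - r0 * X = (D - X) * (r * (1 + t)) + X * (r - r0)
     + X * r * t by ring.
  have r_le2 : r <= 2 by nra.
  have rt0 : 0 <= r * (1 + t) by apply: mulr_ge0 => //; exact: ltW.
  have e1 : `|(D - X) * (r * (1 + t))| <= 4 * t.
    rewrite normrM (ger0_norm rt0).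
    apply: (@le_trans _ _ (t * 4)); last by rewrite mulrC.
    apply: ler_pM => //; first exact: le_trans DX' xt.
    nra.
  have X1 : `|X| <= 1 by nra.
  have e2 : `|X * (r - r0)| <= 3 * t.
    rewrite normrM; apply: (@le_trans _ _ (1 * (3 * s))); first exact: ler_pM.
    by rewrite mul1r ler_wpM2l.
  have e3 : `|X * r * t| <= 2 * t.
    rewrite !normrM (ger0_norm t0) ler_wpM2r// (ger0_norm r_ge0).
    by rewrite -[2]mul1r ler_pM.
  apply: le_trans (ler_normD _ _) _; apply: le_trans (lerD (ler_normD _ _) (lexx _)) _.
  lra.
apply: le_trans (ler_normB _ _) _.
rewrite [`|r0 * X|]normrM [`|D * r * _|]normrM [`|D * r|]normrM.
rewrite (ger0_norm r_ge0) (ger0_norm r00) (gtr0_norm t1).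
(* From [D ^+ 2 <= s] follows [|D| <= 1 + s], and [(1 + s) * r <= 2]. *)
have e1 : `|D| * r <= 2 by nra.
have e2 : r0 * `|X| <= 2 * t by apply: ler_pM => //; nra.
have : `|D| * r * (1 + t) <= 2 * (1 + t) by rewrite ler_wpM2r// ltW.
lra.
Qed.

End LatticeWalkResolvent.

(** * Limits as the mesh tends to zero *)

Lemma cvg_of_harmonic_bound {R : realType} (u : nat -> R) (l C : R) :
  (forall N, `|u N - l| <= C / N.+1%:R) -> u @ \oo --> l.
Proof.
move=> H; apply/subr_cvg0/norm_cvg0P.
apply: (@squeeze_cvgr _ _ _ _ (fun=> 0) (fun N => C * harmonic N)).
- by apply: nearW => N; rewrite normr_ge0 H.
- exact: cvg_cst.
- by rewrite -(mulr0 C); apply: cvgM; [exact: cvg_cst|exact: cvg_harmonic].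
Qed.

Lemma cvg_sumr {R : realType} (I : Type) (r : seq I) (f : nat -> I -> R) (l : I -> R) :
  (forall i, f ^~ i @ \oo --> l i) ->
  (fun N => \sum_(i <- r) f N i) @ \oo --> \sum_(i <- r) l i.
Proof.
move=> H; elim: r => [|i r IH].
  by rewrite big_nil; under eq_fun do rewrite big_nil; exact: cvg_cst.
by rewrite big_cons; under eq_fun do rewrite big_cons; exact: cvgD.
Qed.

Section LatticeWalkLimits.
Context {R : realType} (n : nat).
Implicit Types (x : 'I_n -> R) (k : 'I_n) (N : nat).

Lemma walk_sin_cvg (y : R) : N.+1%:R * sin (y / N.+1%:R) @[N --> \oo] --> y.
Proof.
apply: (@cvg_of_harmonic_bound _ _ _ (y ^+ 2)) => N.
exact: (walk_sin_sub_le (ord0 : 'I_1) N (fun=> y)).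
Qed.

Lemma walk_symbol_cvg x : walk_symbol N x @[N --> \oo] --> \sum_j x j ^+ 2.
Proof.
apply: cvg_sumr => j.
(* In half-angle form each summand is the square of a quantity covered by [walk_sin_cvg]. *)
have -> : (fun N => 2 * N.+1%:R ^+ 2 * (1 - cos (x j / N.+1%:R))) =
    (fun N => (2 * (N.+1%:R * sin ((x j / 2) / N.+1%:R))) ^+ 2).
  apply/funext => N; rewrite one_sub_cosE [x j / 2 / _]mulrAC.
  by move: (N.+1%:R : R) (sin _) => p t; ring.
have -> : x j ^+ 2 = (2 * (x j / 2)) ^+ 2 by congr (_ ^+ _); field.
rewrite expr2; under eq_fun do rewrite expr2.
by apply: cvgM; (apply: cvgM; [exact: cvg_cst|exact: walk_sin_cvg]).
Qed.

(** The ratio is at most its value at symbol 0, whose powers are controlled by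
    [trunc_resolvent_tail] and the choice of [walk_length]. *)
Lemma walk_tail_le N x :
  `|((walk_const n N - 1 - walk_symbol N x) / walk_const n N)
      ^+ (walk_length n N).+1 : R| <= N.+1%:R^-1.
Proof.
have q1 := @walk_const_ge1 R n N.
rewrite normrX; apply: le_trans (_ : ((walk_const n N - 1) / walk_const n N)
  ^+ (walk_length n N).+1 <= _).
  rewrite lerXn2r ?nnegrE ?divr_ge0// ?subr_ge0 ?(le_trans ler01 q1)//.
  exact: (resolvent_ratio_le q1 (walk_symbol_ge0 _ _) (walk_symbol_le_const _ _)).
apply: le_trans (trunc_resolvent_tail _ q1) _.
rewrite ler_pdivrMr// ler_pdivlMl//.
have -> : walk_const n N = (1 + 2 * (n * N.+1 ^ 2))%N%:R :> R.
  by rewrite /walk_const [RHS]natrD [in RHS]natrM.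
rewrite -natrM ler_nat /walk_length ltnW// ltnS.
Qed.

Lemma walk_resolvent_cvg x : walk_resolvent n N (walk_symbol N x) @[N --> \oo]
  --> (1 + \sum_j x j ^+ 2)^-1.
Proof.
have s1 : 0 < 1 + \sum_j x j ^+ 2.
  by rewrite ltr_wpDr// sumr_ge0// => j _; exact: sqr_ge0.
have -> : (fun N => walk_resolvent n N (walk_symbol N x)) = (fun N =>
    (1 - ((walk_const n N - 1 - walk_symbol N x) / walk_const n N)
      ^+ (walk_length n N).+1) * (1 + walk_symbol N x)^-1).
  apply/funext => N; rewrite -trunc_resolventE ?walk_const_ge1// mulrAC mulfV ?mul1r//.
  by rewrite gt_eqF// ltr_wpDr// walk_symbol_ge0.
rewrite -[X in _ --> X]mul1r; apply: cvgM.
  rewrite -[X in _ --> X](subr0 1); apply: cvgB; first exact: cvg_cst.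
  apply: (@cvg_of_harmonic_bound _ _ _ 1) => N.
  by rewrite subr0 mul1r walk_tail_le.
apply: cvgV; first by rewrite gt_eqF.
by apply: cvgD; [exact: cvg_cst|exact: walk_symbol_cvg].
Qed.

Lemma walk_resolvent0_cvg : walk_resolvent n N 0 @[N --> \oo] --> (1 : R).
Proof.
have := @walk_resolvent_cvg (fun=> 0).
rewrite big1 => [|j _]; last by rewrite expr0n.
rewrite addr0 invr1.
suff E : forall N, walk_symbol N (fun=> 0 : R) = 0 :> R by under eq_fun do rewrite E.
by move=> *; rewrite /walk_symbol big1// => j _; rewrite mul0r cos0 subrr mulr0.
Qed.

Lemma walk_error_cvg k x : walk_error k N x @[N --> \oo] --> (0 : R).
Proof.
rewrite -(subrr (x k / (1 + \sum_j x j ^+ 2))); apply: cvgB.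
  by apply: cvgM; [exact: walk_sin_cvg|exact: walk_resolvent_cvg].
rewrite -[X in _ --> X]mul1r; apply: cvgM; last exact: cvg_cst.
exact: walk_resolvent0_cvg.
Qed.

End LatticeWalkLimits.

(** * Finite dimensional inner product spaces *)

Section InnerProductTheory.
Context {R : realType} {V : innerProductSpaceType R}.
Implicit Types (u v w x y : V) (U W : {vspace V}) (e : seq V).

Lemma innerC u v : '(u, v) = '(v, u).
Proof. by have := @hermC _ _ _ _ (@inner R V) u v; rewrite expr0 mul1r. Qed.

Lemma sqr_norm_inner v : `|v| ^+ 2 = '(v, v).
Proof.
rewrite norm_innerE sqr_sqrtr//; have [->|v0] := eqVneq v 0.
  by rewrite linear0l.
exact/ltW/neq0_dnorm_gt0.
Qed.

Lemma innerDl u v w : '(u + v, w) = '(u, w) + '(v, w).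
Proof. exact: linearDl. Qed.

Lemma innerBl u v w : '(u - v, w) = '(u, w) - '(v, w).
Proof. exact: linearBl. Qed.

Lemma innerDr u v w : '(u, v + w) = '(u, v) + '(u, w).
Proof. exact: linearDr. Qed.

Lemma innerBr u v w : '(u, v - w) = '(u, v) - '(u, w).
Proof. exact: linearBr. Qed.

Lemma innerZl (k : R) u v : '(k *: u, v) = k * '(u, v).
Proof. exact: linearZl_LR. Qed.

Lemma innerZr (k : R) u v : '(u, k *: v) = k * '(u, v).
Proof. exact: linearZr_LR. Qed.

Lemma inner_suml (I : Type) (r : seq I) (F : I -> V) v :
  '(\sum_(i <- r) F i, v) = \sum_(i <- r) '(F i, v).
Proof. exact: linear_sumlz. Qed.

Lemma inner_sumr (I : Type) (r : seq I) (F : I -> V) v :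
  '(v, \sum_(i <- r) F i) = \sum_(i <- r) '(v, F i).
Proof. exact: linear_sumr. Qed.

Lemma inner0l v : '(0, v) = 0.
Proof. exact: linear0l. Qed.

Lemma inner0r v : '(v, 0) = 0.
Proof. exact: linear0r. Qed.

Lemma cauchy_schwarz u v : `|'(u, v)| <= `|u| * `|v|.
Proof.
have [->|v0] := eqVneq v 0; first by rewrite inner0r normr0 normr0 mulr0.
have nv0 : 0 < `|v| by rewrite normr_gt0.
have H t : 0 <= `|u| ^+ 2 - 2 * t * '(u, v) + t ^+ 2 * `|v| ^+ 2.
  have : 0 <= '(u - t *: v, u - t *: v) by rewrite -sqr_norm_inner exprn_ge0.
  rewrite innerBl !innerBr !innerZl !innerZr (innerC v u) -!sqr_norm_inner.
  by congr (_ <= _); ring.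
have := H ('(u, v) / `|v| ^+ 2).
have -> : `|u| ^+ 2 - 2 * ('(u, v) / `|v| ^+ 2) * '(u, v)
    + ('(u, v) / `|v| ^+ 2) ^+ 2 * `|v| ^+ 2 = `|u| ^+ 2 - '(u, v) ^+ 2 / `|v| ^+ 2.
  by field; exact: lt0r_neq0.
rewrite subr_ge0 ler_pdivrMr ?exprn_gt0// -exprMn -(real_normK (num_real '(u, v))).
by rewrite ler_pXn2r// nnegrE mulr_ge0.
Qed.

(** Gram-Schmidt by induction on the dimension: split off a unit vector [x] of [U] and recurse on
    the part of [U] orthogonal to [x]. *)
Lemma exists_orthonormal_expansion U :
  exists2 e : seq V, (forall x, x \in e -> x \in U) &
    forall v, v \in U -> v = \sum_(x <- e) '(v, x) *: x.
Proof.
have [n] := ubnP (\dim U); elim: n U => // n IH U dU.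
have [U0|U0] := eqVneq U 0%VS.
  exists [::] => // v; rewrite U0 memv0 => /eqP ->; by rewrite big_nil.
pose w := vpick U; have w0 : w != 0 by rewrite vpick0.
pose x := `|w|^-1 *: w.
have xU : x \in U by rewrite memvZ// memv_pick.
have xx : '(x, x) = 1.
  rewrite innerZl innerZr -sqr_norm_inner .
  by field; rewrite normr_eq0.
pose U' := (U :&: orthov (@inner R V) <[x]>)%VS.
have x0 : x != 0 by apply/eqP => x0; move: xx; rewrite x0 inner0l => /esym/eqP; rewrite oner_eq0.
have [e eU' He] : exists2 e : seq V, (forall z, z \in e -> z \in U') &
    forall v, v \in U' -> v = \sum_(z <- e) '(v, z) *: z.
  apply: IH; rewrite -ltnS; apply: leq_trans dU; rewrite ltnS.
  have := capvSl U (orthov (@inner R V) <[x]>); rewrite -/U' => sU.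
  rewrite ltn_neqAle dimvS// andbT; apply/eqP => dE.
  have : (U' == U)%VS by rewrite eqEdim sU dE/=.
  move=> /eqP UE; move: xU; rewrite -UE memv_cap => /andP[_].
  move/mem_orthovP => /(_ x (memv_line x)) xx0.
  by have := oner_neq0 R; rewrite -xx [X in X != _]xx0 eqxx.
exists (x :: e) => [z|v vU].
  rewrite inE => /orP[/eqP ->//|/eU']; by rewrite memv_cap => /andP[].
pose v' := v - '(v, x) *: x.
have v'U : v' \in U'.
  rewrite memv_cap; apply/andP; split; first by apply: memvB => //; exact: memvZ.
  apply/mem_orthovP => z /vlineP[k ->].
  by rewrite -[LHS]/('(v', k *: x)) innerZr innerBl innerZl xx mulr1 subrr mulr0.
rewrite big_cons -[LHS](subrK ('(v, x) *: x)) addrC -/v'; congr (_ + _).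
rewrite {1}(He _ v'U); apply: eq_big_seq => z /eU'; rewrite memv_cap => /andP[_].
move/mem_orthovP => /(_ x (memv_line x)) zx.
have xz : '(x, z) = 0 by rewrite innerC.
by rewrite innerBl innerZl xz mulr0 subr0.
Qed.

Lemma sqr_norm_expansion e v : v = \sum_(x <- e) '(v, x) *: x ->
  `|v| ^+ 2 = \sum_(x <- e) '(v, x) ^+ 2.
Proof.
move=> ve; rewrite sqr_norm_inner {2}ve inner_sumr.
by apply: eq_bigr => x _; rewrite innerZr expr2.
Qed.

Lemma exists_orthogonal_projection U : exists P : V -> V,
  [/\ forall v, P v \in U, forall v, v \in U -> P v = v &
      forall v u, u \in U -> '(v - P v, u) = 0].
Proof.
have [e eU He] := exists_orthonormal_expansion U.
exists (fun v => \sum_(x <- e) '(v, x) *: x); split.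
- by move=> v; rewrite big_seq memv_suml// => x /eU; exact: memvZ.
- by move=> v /He.
- move=> v u /He ue; rewrite innerBl inner_suml {1}ue inner_sumr -sumrB.
  apply: big1 => x _; rewrite innerZr innerZl (innerC x) .
  by rewrite mulrC subrr.
Qed.

(** Testing with [y = v - P v], for the orthogonal projection [P] onto [U], gives
    [|v - P v| ^+ 2 = 0]. *)
Lemma orthogonal_orthogonal U v :
  (forall y, (forall u, u \in U -> '(y, u) = 0) -> '(v, y) = 0) -> v \in U.
Proof.
have [P [PU _ Porth]] := exists_orthogonal_projection U => vU.
suff /eqP : `|v - P v| ^+ 2 = 0.
  by rewrite sqrf_eq0 normr_eq0 subr_eq0 => /eqP ->.
rewrite sqr_norm_inner innerBl vU ?sub0r => [|u]; last exact: Porth.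
by rewrite innerC Porth ?oppr0.
Qed.

Lemma exists_adjoint (S : 'End(V)) (y : V) : exists z, forall v, '(S v, y) = '(v, z).
Proof.
have [e _ He] := exists_orthonormal_expansion fullv.
exists (\sum_(x <- e) '(S x, y) *: x) => v.
rewrite {1}(He v (memvf v)) linear_sum/= inner_suml inner_sumr.
apply: eq_bigr => x _; rewrite linearZ/= innerZl innerZr mulrC.
by rewrite  mulrC.
Qed.

Lemma exists_linear_bound (S : 'End(V)) : exists2 C, 0 <= C & forall v, `|S v| <= C * `|v|.
Proof.
have [e _ He] := exists_orthonormal_expansion fullv.
exists (\sum_(x <- e) `|x| * `|S x|).
  by apply: sumr_ge0 => x _; rewrite mulr_ge0.
move=> v; rewrite {1}(He v (memvf v)) linear_sum/= mulr_suml.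
apply: le_trans (ler_norm_sum _ _ _) _; apply: ler_sum => x _.
rewrite linearZ/= normrZ mulrAC ler_wpM2r//.
by apply: le_trans (cauchy_schwarz _ _) _; rewrite mulrC.
Qed.

Lemma inner_continuous y : continuous (fun v => '(v, y)).
Proof.
move=> v; apply/cvgrPdist_le => e e0.
have y0 : 0 < 1 + `|y| by rewrite ltr_wpDr.
near=> w; rewrite -innerBl; apply: le_trans (cauchy_schwarz _ _) _.
apply: (@le_trans _ _ (e / (1 + `|y|) * (1 + `|y|))); last first.
  by rewrite divfK// gt_eqF.
rewrite ler_pM// ?lerDr//; near: w.
apply: cvgr_dist_le; first exact: cvg_id.
by rewrite divr_gt0.
Unshelve. all: by end_near. Qed.

Lemma lfun_continuous (S : 'End(V)) : continuous (S : V -> V).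
Proof.
have [C C0 SC] := exists_linear_bound S.
move=> v; apply/cvgrPdist_le => e e0.
have y0 : 0 < 1 + C by rewrite ltr_wpDr.
near=> w; rewrite -linearB; apply: le_trans (SC _) _.
apply: (@le_trans _ _ ((1 + C) * (e / (1 + C)))); last first.
  by rewrite mulrC divfK// gt_eqF.
rewrite ler_pM// ?lerDr//; near: w.
apply: cvgr_dist_le; first exact: cvg_id.
by rewrite divr_gt0.
Unshelve. all: by end_near. Qed.

Lemma continuous_measurable_borel (f : V -> V) : continuous f ->
  measurable_fun [set: borel V] (f : borel V -> borel V).
Proof.
move=> /continuousP cf; apply: (@measurability _ _ (borel V) (borel V) setT f (@open V)) => //.
move=> _ [B oB <-]; rewrite setTI; apply: sub_gen_smallest; exact: cf.
Qed.

Lemma continuous_measurable_real (f : V -> R) : continuous f ->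
  measurable_fun [set: borel V] (f : borel V -> R).
Proof.
move=> /continuousP cf; apply: (measurability _ (RGenOpens.measurableE R)).
move=> _ [_ [a [b ->] <-]]; rewrite setTI; apply: sub_gen_smallest.
exact/cf/interval_open.
Qed.

Lemma inner_measurable y :
  measurable_fun [set: borel V] ((fun v : V => '(v, y)) : borel V -> R).
Proof. exact: (continuous_measurable_real (@inner_continuous y)). Qed.

Lemma translation_measurable h :
  measurable_fun [set: borel V] (fun v : borel V => (v : V) + h : borel V).
Proof.
apply: continuous_measurable_borel => v.
by apply: cvgD; [exact: cvg_id|exact: cvg_cst].
Qed.

Lemma lfun_measurable (S : 'End(V)) :
  measurable_fun [set: borel V] (S : borel V -> borel V).
Proof. exact: (continuous_measurable_borel (lfun_continuous (S := S))). Qed.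

(** Describes [U] by finitely many linear equations, so that its measurability and almost sure
    membership in it reduce to one equation at a time. *)
Lemma exists_orthogonal_equations U : exists2 e : seq V,
  (forall y u, y \in e -> u \in U -> '(y, u) = 0) &
  (forall v, (forall y, y \in e -> '(v, y) = 0) -> v \in U).
Proof.
have [e eU He] := exists_orthonormal_expansion (orthov (@inner R V) U).
exists e => [y u /eU /mem_orthovP yU uU|v ve]; first exact: yU.
apply: orthogonal_orthogonal => y yU.
rewrite (He y); last by apply/mem_orthovP => u; exact: yU.
by rewrite inner_sumr big_seq big1// => x /ve vx; rewrite innerZr vx mulr0.
Qed.

Lemma subspace_measurable U : measurable ([set` U] : set (borel V)).
Proof.
have [e eU Ue] := exists_orthogonal_equations U.
have -> : [set` U] = \bigcap_(y in [set` e])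
    (((fun v : V => '(v, y)) : borel V -> R) @^-1` [set 0]) :> set (borel V).
  apply/seteqP; split => v /= vU; last by apply: Ue => y /vU.
  by move=> y /= ye; rewrite innerC eU.
apply: fin_bigcap_measurable => // y _.
rewrite -[X in measurable X]setTI; exact: inner_measurable.
Qed.

End InnerProductTheory.

(** * Image measures and characteristic functions *)

Section ImageMeasures.
Context {R : realType} {V : innerProductSpaceType R}.
Implicit Types (nu : {measure set (borel V) -> \bar R}) (mu : probability (borel V) R).
Implicit Types (S : 'End(V)) (h u v : V) (W : {vspace V}).

Definition affine_map S h : borel V -> borel V := fun v => S (v : V) + h.

Lemma affine_map_measurable S h : measurable_fun [set: borel V] (affine_map S h).
Proof.
exact: (measurableT_comp (@translation_measurable R V h) (@lfun_measurable R V S)).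
Qed.

Lemma measurable_affine_preimage S h (E : set (borel V)) :
  measurable E -> measurable (affine_map S h @^-1` E).
Proof.
by move=> mE; rewrite -[X in measurable X]setTI; exact: affine_map_measurable.
Qed.

Lemma affine_map_idE h : affine_map \1%VF h = (fun v : borel V => (v : V) + h : borel V).
Proof. by apply/funext => v; rewrite /affine_map id_lfunE. Qed.

(** The point mass of a section of the preimage of [E] is the indicator of the translated event. *)
Lemma convolution_point_mass nu h (E : set (borel V)) : measurable E ->
  convolution nu (point_mass h) E = nu (affine_map \1%VF h @^-1` E).
Proof.
move=> mE; rewrite -[X in _ = nu X]setIT -integral_indic//; last first.
  exact: measurable_affine_preimage.
rewrite /convolution /pushforward /product_measure1; apply: eq_integral => v _.
rewrite /= /point_mass diracE indicE; congr (_%:R%:E).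
congr nat_of_bool; rewrite -[RHS]/(v \in (affine_map \1%VF h @^-1` E)).
by apply/idP/idP; rewrite !inE /xsection/= ?inE /= affine_map_idE.
Qed.

Lemma convolution_image_point_mass nu S h (E : set (borel V)) : measurable E ->
  convolution (image_measure S nu) (point_mass h) E = nu (affine_map S h @^-1` E).
Proof.
move=> mE; rewrite /image_measure.
have mS := @lfun_measurable R V S.
rewrite (convolution_point_mass
  (measure_function_pushforward__canonical__measure_function_Measure nu mS))//.
by rewrite /= /pushforward affine_map_idE.
Qed.

Lemma is_symmetryP nu S : is_symmetry nu S <->
  exists h, forall E, measurable E -> nu E = nu (affine_map S h @^-1` E).
Proof.
by split=> -[h H]; exists h => E mE; rewrite H// convolution_image_point_mass.
Qed.

Lemma integral_affine_image mu S h (g : V -> R) :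
  (forall E, measurable E -> mu E = mu (affine_map S h @^-1` E)) ->
  measurable_fun [set: borel V] (g : borel V -> R) ->
  (forall v, `|g v| <= 1) ->
  \int[mu]_v g v = \int[mu]_v g (S v + h).
Proof.
move=> H mg g1; rewrite /Rintegral; congr fine.
have mS := affine_map_measurable S h.
rewrite (eq_measure_integral
  (measure_function_pushforward__canonical__measure_function_Measure mu mS)); last first.
  by move=> A mA _; exact: H.
rewrite integral_pushforward ?preimage_setT//.
  exact/measurable_EFinP.
apply: (measurable_bounded_integrable (f := g \o affine_map S h)) => //.
- by apply: le_lt_trans (@probability_le1 _ _ _ mu _ measurableT) _; rewrite ltry.
- exact: measurableT_comp.
- by exists 1; split=> // x x1 v _ /=; exact: le_trans (g1 _) (ltW x1).
Qed.

End ImageMeasures.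

(** * Real and imaginary parts of the Levy exponent *)

Section CharacteristicFunction.
Context {R : realType} {V : innerProductSpaceType R}.
Implicit Types (M : {measure set (borel V) -> \bar R}) (mu : probability (borel V) R).
Implicit Types (S : 'End(V)) (h m u v y : V) (W : {vspace V}).

Local Open Scope complex_scope.

Lemma affine_subspace_measurable W h :
  measurable (affine_subspace W h : set (borel V)).
Proof.
have -> : affine_subspace W h = affine_map \1%VF (- h) @^-1` [set` W].
  apply/seteqP; split => v /=; rewrite affine_map_idE.
    by move=> [w /= wW <-]; rewrite addrK.
  by move=> vW; exists (v - h); rewrite ?subrK.
by apply: measurable_affine_preimage; exact: subspace_measurable.
Qed.

Definition levy_re (D : 'End(V)) M u : R :=
  - '(D u, u) / 2 + \int[M]_(v in [set v : V | v != 0]) (cos '(v, u) - 1).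

Definition levy_im m M u : R :=
  '(m, u) + \int[M]_(v in [set v : V | v != 0])
    (sin '(v, u) - '(v, u) / (1 + `|v| ^+ 2)).

Lemma cexp_imaginary (x : R) : cexp ('i * x%:C) = cos x +i* sin x.
Proof.
have -> : 'i * x%:C = 0 +i* x :> R[i] by simpc.
by rewrite /cexp expR0 !mul1r.
Qed.

Lemma charfunE mu u :
  charfun mu u = (\int[mu]_v cos '(v, u)) +i* (\int[mu]_v sin '(v, u)).
Proof.
rewrite /charfun /cintegral; congr (_ +i* _); apply: eq_Rintegral => v _;
by rewrite cexp_imaginary.
Qed.

Lemma levy_integrandE (x c : R) :
  cexp ('i * x%:C) - 1 - 'i * x%:C / c%:C = (cos x - 1) +i* (sin x - x / c).
Proof.
rewrite cexp_imaginary -fmorphV.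
have -> : 'i * x%:C * (c^-1)%:C = 0 +i* (x / c) :> R[i] by simpc.
by apply/eqP; rewrite eq_complex /= !subr0 !eqxx.
Qed.

Lemma levy_exponentE m (D : 'End(V)) M u :
  levy_exponent m D M u = levy_re D M u +i* levy_im m M u.
Proof.
rewrite /levy_exponent.
have -> : cintegral M [set v | v != 0] (fun v =>
      cexp ('i%C * '(v, u)%:C) - 1 - 'i%C * '(v, u)%:C / (1 + `|v| ^+ 2)%:C) =
    (\int[M]_(v in [set v : V | v != 0]) (cos '(v, u) - 1)) +i*
    (\int[M]_(v in [set v : V | v != 0]) (sin '(v, u) - '(v, u) / (1 + `|v| ^+ 2))).
  by congr (_ +i* _); apply: eq_Rintegral => v _; rewrite levy_integrandE.
have -> : 2^-1 = (2^-1 : R)%:C :> R[i] by rewrite fmorphV rmorph_nat.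
apply/eqP; rewrite eq_complex /levy_re /levy_im /=; apply/andP; split; apply/eqP; ring.
Qed.

Section LevyTriple.
Variables (m : V) (D : 'End(V)) (M : {measure set (borel V) -> \bar R}).
Variable mu : probability (borel V) R.
Hypothesis muE : is_levy_triple mu m D M.

Lemma integral_cosE u : \int[mu]_v cos '(v, u) =
  expR (levy_re D M u) * cos (levy_im m M u).
Proof.
by case: muE => _ _ _ _ /(_ u); rewrite charfunE levy_exponentE /= => -[].
Qed.

Lemma integral_sinE u : \int[mu]_v sin '(v, u) =
  expR (levy_re D M u) * sin (levy_im m M u).
Proof.
by case: muE => _ _ _ _ /(_ u); rewrite charfunE levy_exponentE /= => -[].
Qed.

Lemma cos_inner_measurable u :
  measurable_fun [set: borel V] ((fun v : V => cos '(v, u)) : borel V -> R).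
Proof.
apply: continuous_measurable_real => v.
exact: (continuous_comp (@inner_continuous R V u v) (@continuous_cos R _)).
Qed.

Lemma sin_inner_measurable u :
  measurable_fun [set: borel V] ((fun v : V => sin '(v, u)) : borel V -> R).
Proof.
apply: continuous_measurable_real => v.
exact: (continuous_comp (@inner_continuous R V u v) (@continuous_sin R _)).
Qed.

Lemma cos_inner_integrable u :
  mu.-integrable [set: borel V] (fun v : borel V => (cos '((v : V), u))%:E).
Proof.
apply: measurable_bounded_integrable => //.
- by apply: le_lt_trans (@probability_le1 _ _ _ mu _ measurableT) _; rewrite ltry.
- exact: cos_inner_measurable.
- by exists 1; split=> // x x1 v _ /=; exact: le_trans (cos_max _) (ltW x1).
Qed.

Lemma sin_inner_integrable u :
  mu.-integrable [set: borel V] (fun v : borel V => (sin '((v : V), u))%:E).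
Proof.
apply: measurable_bounded_integrable => //.
- by apply: le_lt_trans (@probability_le1 _ _ _ mu _ measurableT) _; rewrite ltry.
- exact: sin_inner_measurable.
- by exists 1; split=> // x x1 v _ /=; exact: le_trans (sin_max _) (ltW x1).
Qed.

(** The vector [u'] is the adjoint of [S] applied to [u], so the characteristic function at [u] is
    the one at [u'] times the phase of ['(h, u)]. Hence the phases agree modulo pi. *)
Lemma sin_levy_im_symmetry S h :
  (forall E, measurable E -> mu E = mu (affine_map S h @^-1` E)) ->
  forall u u', (forall v, '(S v, u) = '(v, u')) ->
  sin (levy_im m M u - ('(h, u) + levy_im m M u')) = 0.
Proof.
move=> muS u u' uu'.
have cu : \int[mu]_v cos '(v, u) = cos '(h, u) * \int[mu]_v cos '(v, u')
    - sin '(h, u) * \int[mu]_v sin '(v, u').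
  rewrite (integral_affine_image muS (@cos_inner_measurable u)); last first.
    by move=> v; exact: cos_max.
  rewrite -RintegralZl//; last exact: cos_inner_integrable.
  rewrite -RintegralZl//; last exact: sin_inner_integrable.
  rewrite -RintegralB//=; first last.
  - exact: (integrableZl measurableT _ (sin_inner_integrable u')).
  - exact: (integrableZl measurableT _ (cos_inner_integrable u')).
  by apply: eq_Rintegral => v _; rewrite innerDl uu' cosD mulrC (mulrC (sin _)).
have su : \int[mu]_v sin '(v, u) = sin '(h, u) * \int[mu]_v cos '(v, u')
    + cos '(h, u) * \int[mu]_v sin '(v, u').
  rewrite (integral_affine_image muS (@sin_inner_measurable u)); last first.
    by move=> v; exact: sin_max.
  rewrite -RintegralZl//; last exact: cos_inner_integrable.
  rewrite -RintegralZl//; last exact: sin_inner_integrable.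
  rewrite -RintegralD//=; first last.
  - exact: (integrableZl measurableT _ (sin_inner_integrable u')).
  - exact: (integrableZl measurableT _ (cos_inner_integrable u')).
  apply: eq_Rintegral => v _; rewrite innerDl uu' sinD; ring.
move: cu su; rewrite !integral_cosE !integral_sinE.
have : expR (levy_re D M u) != 0 by rewrite gt_eqF// expR_gt0.
move: (expR (levy_re D M u)) (expR (levy_re D M u')) (levy_im m M u)
  (levy_im m M u') '(h, u) => a a' b b' c a0 cu su.
(* Scaling by the modulus [a] turns [a * cos b] and [a * sin b] into expressions in [a'], which
   cancel. *)
apply: (mulfI a0); rewrite mulr0 sinB mulrBr !mulrA su cu cosD sinD.
ring.
Qed.

(** Almost surely ['(v, u)] equals the constant ['(h, u)], so the characteristic function has
    modulus 1 at [u]. *)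
Lemma levy_re_eq0 W h u : mu (affine_subspace W h) = 1%E ->
  (forall w, w \in W -> '(w, u) = 0) -> levy_re D M u = 0.
Proof.
move=> mu1 Wu.
have mA : measurable (affine_subspace W h : set (borel V)).
  exact: affine_subspace_measurable.
have muC : mu (~` affine_subspace W h) = 0%E.
  by rewrite (probability_setC mu mA) mu1 subee.
have E (g : R -> R) : mu.-integrable [set: borel V] (fun v : borel V => (g '((v : V), u))%:E) ->
    \int[mu]_v g '(v, u) = g '(h, u).
  move=> ig; rewrite /Rintegral (negligible_integral (measurableC mA) measurableT ig muC).
  rewrite setTD setCK.
  rewrite (eq_integral (cst (g '(h, u))%:E)) => [|v /set_mem[w /= wW <-]].
    by rewrite integral_cst// [X in (_ * X)%E]mu1 mule1.
  by rewrite innerDl Wu// add0r.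
have := E _ (cos_inner_integrable u); have := E _ (sin_inner_integrable u).
rewrite integral_cosE integral_sinE => s c.
have : expR (levy_re D M u) ^+ 2 = 1.
  rewrite -[LHS]mulr1 -(cos2Dsin2 (levy_im m M u)) mulrDr -!exprMn s c.
  by rewrite !cos2Dsin2.
move=> /eqP; rewrite sqrf_eq1 => /orP[/eqP|/eqP e].
  by rewrite -expR0 => /expR_inj.
by have := expR_gt0 (levy_re D M u); rewrite e ltrNr oppr0 ltr10.
Qed.

End LevyTriple.
End CharacteristicFunction.

(** * The Levy measure *)

Lemma eq0_of_sin_eq0 {R : realType} (J : R -> R) : {within `[0, 1], continuous J} ->
  J 0 = 0 -> (forall t, 0 <= t <= 1 -> sin (J t) = 0) -> J 1 = 0.
Proof.
move=> cJ J0 sJ; apply/eqP/negPn/negP => J1.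
(* A value between 0 and [J 1], hence attained by [J]; its modulus lies in []0, 1]], where [sin]
   does not vanish. *)
pose c : R := Num.sg (J 1) * Num.min `|J 1| 1.
have nJ : 0 < `|J 1| by rewrite normr_gt0.
have c01 : 0 < Num.min `|J 1| 1 <= 1 by rewrite lt_min nJ ltr01 ge_min lexx orbT.
have [|t] := @IVT R J 0 1 c ler01 cJ.
  rewrite J0 /c; have [j0|j0] := ltP 0 (J 1).
    rewrite gtr0_sg// mul1r (gtr0_norm j0).
    by rewrite le_min ge_min lexx ler01 ltW.
  have {}j0 : J 1 < 0 by rewrite lt_neqAle J1.
  rewrite ltr0_sg// mulN1r (ltr0_norm j0) lerNr oppr_le0 ge_min lexx.
  by rewrite /= le_min oppr_ge0 ltW//= ler01.
rewrite in_itv/= => t01 Jt.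
have := sJ _ t01; rewrite Jt /c sin_sg => /eqP; rewrite mulf_eq0 sgr_eq0 (negPf J1)/=.
apply/negP; rewrite gt_eqF// sin2_gt0//; move: c01 => /andP[-> c1] /=.
by apply: le_lt_trans c1 _; lra.
Qed.

Lemma Rintegral_setD_null d (T : measurableType d) (R : realType)
    (mu : {measure set T -> \bar R}) (D N : set T) (f : T -> R) :
  measurable D -> measurable N -> N `<=` D -> mu (D `\` N) = 0%E ->
  mu.-integrable D (EFin \o f) ->
  \int[mu]_(x in D) f x = \int[mu]_(x in N) f x.
Proof.
move=> mD mN ND muN intf; rewrite /Rintegral; congr fine.
by rewrite (negligible_integral (measurableD mD mN) mD intf muN) setDD setIidr.
Qed.

Section LevyMeasure.
Context {R : realType} {V : innerProductSpaceType R}.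
Variable M : {measure set (borel V) -> \bar R}.
Implicit Types (S : 'End(V)) (h m u v y : V) (W : {vspace V}).

Definition levy_weight v : R := `|v| ^+ 2 / (1 + `|v| ^+ 2).

Definition punctured : set (borel V) := [set v : V | v != 0].

Definition punctured_subspace W : set (borel V) := [set v : V | v \in W /\ v != 0].

Lemma punctured_measurable : measurable punctured.
Proof.
have := measurableC (@subspace_measurable R V 0%VS); congr measurable.
by apply/seteqP; split => v /=; rewrite memv0 => /negP.
Qed.

Lemma punctured_subspace_measurable W : measurable (punctured_subspace W).
Proof.
exact: (measurableI _ _ (@subspace_measurable R V W) punctured_measurable).
Qed.

Lemma punctured_subspace_sub W : punctured_subspace W `<=` punctured.
Proof. by move=> v [_]. Qed.

Lemma levy_weight_measurable :
  measurable_fun [set: borel V] (levy_weight : borel V -> R).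
Proof.
apply: continuous_measurable_real => v; apply: cvgM.
  by rewrite expr2; under eq_fun do rewrite expr2; apply: cvgM; exact: norm_continuous.
apply: cvgV; first by rewrite gt_eqF// ltr_wpDr ?exprn_ge0.
apply: cvgD; first exact: cvg_cst.
by rewrite expr2; under eq_fun do rewrite expr2; apply: cvgM; exact: norm_continuous.
Qed.

Lemma levy_weight_ge0 v : 0 <= levy_weight v.
Proof. by rewrite divr_ge0 ?addr_ge0 ?exprn_ge0. Qed.

Hypothesis M_fin : (\int[M]_(v in punctured) (levy_weight v)%:E < +oo)%E.

Lemma levy_weight_integrable :
  M.-integrable punctured (fun v : borel V => (levy_weight v)%:E).
Proof.
apply/integrableP; split.
  by apply/measurable_EFinP; apply: measurable_funTS; exact: levy_weight_measurable.
under eq_integral do rewrite gee0_abs ?lee_fin ?levy_weight_ge0//.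
exact: M_fin.
Qed.

Lemma levy_dominated_integrable (A : set (borel V)) (f : V -> R) (C : R) :
  measurable A -> A `<=` punctured ->
  measurable_fun [set: borel V] (f : borel V -> R) ->
  (forall v, A v -> `|f v| <= C * levy_weight v) ->
  M.-integrable A (fun v : borel V => (f v)%:E).
Proof.
move=> mA A0 mf fC.
apply: (@le_integrable _ _ _ M A mA _ (fun v : borel V => C%:E * (levy_weight v)%:E)%E).
- by apply/measurable_EFinP; exact: measurable_funTS.
- move=> v Av; rewrite -EFinM /= lee_fin; apply: le_trans (fC _ Av) (ler_norm _).
- apply: integrableZl => //.
  exact: (integrableS punctured_measurable mA A0 levy_weight_integrable).
Qed.

(** Over the common denominator the numerator is [sin p - p], at most [p ^+ 2] in modulus, plus
    [sin p * |v| ^+ 2], with [p = '(v, u)]; Cauchy-Schwarz bounds [p]. *)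
Lemma levy_sin_bound u v :
  `|sin '(v, u) - '(v, u) / (1 + `|v| ^+ 2)| <= (1 + `|u| ^+ 2) * levy_weight v.
Proof.
have v1 : 0 < 1 + `|v| ^+ 2 by rewrite ltr_wpDr ?exprn_ge0.
have -> : sin '(v, u) - '(v, u) / (1 + `|v| ^+ 2) =
   (sin '(v, u) - '(v, u) + sin '(v, u) * `|v| ^+ 2) / (1 + `|v| ^+ 2).
  by field; rewrite gt_eqF.
rewrite normrM (gtr0_norm (x := _^-1)) ?invr_gt0// /levy_weight mulrA ler_pM2r ?invr_gt0//.
apply: le_trans (ler_normD _ _) _; rewrite mulrDl mul1r addrC lerD//.
  by rewrite normrM (ger0_norm (x := _ ^+ 2)) ?exprn_ge0// ler_piMl ?exprn_ge0// sin_max.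
apply: le_trans (normr_sin_sub_le _) _.
rewrite -real_normK ?num_real// -exprMn lerXn2r ?nnegrE ?mulr_ge0// mulrC.
exact: cauchy_schwarz.
Qed.

Lemma levy_cos_bound u v :
  `|cos '(v, u) - 1| <= (2 + `|u| ^+ 2) * levy_weight v.
Proof.
have v1 : 0 < 1 + `|v| ^+ 2 by rewrite ltr_wpDr ?exprn_ge0.
rewrite distrC ger0_norm ?subr_ge0 ?cos_le1// /levy_weight mulrA ler_pdivlMr//.
rewrite mulrDr mulr1.
have := one_sub_cos_le_sqr '(v, u); have := cos_geN1 '(v, u).
have : '(v, u) ^+ 2 <= `|v| ^+ 2 * `|u| ^+ 2.
  rewrite -real_normK ?num_real// -exprMn lerXn2r ?nnegrE ?mulr_ge0//.
  exact: cauchy_schwarz.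
have : 0 <= `|v| ^+ 2 by rewrite exprn_ge0.
have : 0 <= `|v| ^+ 2 * `|u| ^+ 2 by rewrite mulr_ge0 ?exprn_ge0.
nra.
Qed.

Lemma levy_sin_measurable u : measurable_fun [set: borel V]
  ((fun v : V => sin '(v, u) - '(v, u) / (1 + `|v| ^+ 2)) : borel V -> R).
Proof.
apply: continuous_measurable_real => v; apply: cvgB.
  exact: (continuous_comp (@inner_continuous R V u v) (@continuous_sin R _)).
apply: cvgM; first exact: inner_continuous.
apply: cvgV; first by rewrite gt_eqF// ltr_wpDr ?exprn_ge0.
apply: cvgD; first exact: cvg_cst.
by rewrite expr2; under eq_fun do rewrite expr2; apply: cvgM; exact: norm_continuous.
Qed.

Lemma levy_sin_integrable u : M.-integrable punctured
  (fun v : borel V => (sin '((v : V), u) - '((v : V), u) / (1 + `|v : V| ^+ 2))%:E).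
Proof.
apply: (levy_dominated_integrable punctured_measurable _ (levy_sin_measurable u)) => //.
by move=> v _; exact: levy_sin_bound.
Qed.

Lemma levy_cos_integrable u : M.-integrable punctured
  (fun v : borel V => (cos '((v : V), u) - 1)%:E).
Proof.
apply: (@levy_dominated_integrable _ _ (2 + `|u| ^+ 2) punctured_measurable) => //.
  apply: continuous_measurable_real => v; apply: cvgB; last exact: cvg_cst.
  exact: (continuous_comp (@inner_continuous R V u v) (@continuous_cos R _)).
by move=> v _; exact: levy_cos_bound.
Qed.

Lemma inner_scale_continuous u v : continuous (fun s : R => '(v, s *: u)).
Proof.
move=> s; rewrite /continuous_at innerZr; under eq_fun do rewrite innerZr.
by apply: cvgM; [exact: cvg_id|exact: cvg_cst].
Qed.

(** The open interval contains the segment [[0, 1]] along which the phases are compared, and on it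
    one multiple of [levy_weight] dominates all the integrands. *)
Lemma levy_im_scale_continuous m u (t : R) : t \in `]-1, 2[ ->
  {for t, continuous (fun s : R => levy_im m M (s *: u))}.
Proof.
move=> t2; apply: cvgD.
  exact: inner_scale_continuous.
have := @continuity_under_integral R _ (borel V) M
  (fun s v => sin '((v : V), s *: u) - '((v : V), s *: u) / (1 + `|v : V| ^+ 2))
  punctured punctured_measurable (-1) 2 _ _
  (* The factor 4 bounds [s ^+ 2] on []-1, 2[]. *)
  (fun v => (1 + 4 * `|u| ^+ 2) * levy_weight v) _ _.
apply => //.
- by move=> s _; exact: levy_sin_integrable.
- apply: aeW => v _ s _; apply: cvgB.
    apply: (@continuous_comp _ _ _ (fun s : R => '((v : V), s *: u)) sin);
      last exact: continuous_sin.
    exact: inner_scale_continuous.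
  apply: cvgM; last exact: cvg_cst.
  exact: inner_scale_continuous.
- exact: (integrableZl punctured_measurable _ levy_weight_integrable).
- move=> s /=; rewrite in_itv/= => /andP[s1 s2]; apply: aeW => v _.
  apply: le_trans (levy_sin_bound _ _) _; rewrite ler_wpM2r ?levy_weight_ge0//.
  rewrite lerD2l normrZ exprMn ler_wpM2r ?exprn_ge0//.
  by rewrite real_normK ?num_real//; nra.
- exact/mem_set.
Qed.

Lemma levy_im_symmetry (D : 'End(V)) m (mu : probability (borel V) R) S h :
  is_levy_triple mu m D M ->
  (forall E, measurable E -> mu E = mu (affine_map S h @^-1` E)) ->
  forall u u', (forall v, '(S v, u) = '(v, u')) ->
  levy_im m M u = '(h, u) + levy_im m M u'.
Proof.
move=> muE muS u u' uu'; apply/eqP; rewrite -subr_eq0; apply/eqP.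
rewrite -(scale1r u) -(scale1r u').
(* The phase discrepancy along the segment from 0 to [u]; scaling preserves the adjoint relation
   between [u] and [u']. *)
pose J t := levy_im m M (t *: u) - ('(h, t *: u) + levy_im m M (t *: u')).
rewrite -/(J 1); apply: eq0_of_sin_eq0.
- apply: continuous_in_subspaceT => t; rewrite inE/= in_itv/= => /andP[t0 t1].
  have t2 : t \in `]-1, 2[ by rewrite in_itv/=; lra.
  apply: cvgB; first exact: levy_im_scale_continuous.
  apply: cvgD; last exact: levy_im_scale_continuous.
  exact: inner_scale_continuous.
- have E w : levy_im m M (0 *: w) = 0.
    rewrite /levy_im scale0r inner0r add0r; under eq_Rintegral do rewrite inner0r sin0 mul0r subrr.
    by rewrite /Rintegral integral0.
  by rewrite /J !E scale0r inner0r addr0 subrr.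
- move=> t _; apply: (sin_levy_im_symmetry muE muS) => v.
  by rewrite !innerZr uu'.
Qed.

(** Both the Gaussian term and the integral are non-positive, so each vanishes; the non-negative
    integrand [1 - cos] is then null almost everywhere. *)
Lemma levy_re_eq0_ae (D : 'End(V)) u :
  (forall u, 0 <= '(D u, u)) -> levy_re D M u = 0 ->
  {ae M, forall v, punctured v -> cos '((v : V), u) = 1}.
Proof.
move=> D0; rewrite /levy_re => /eqP.
have c0 : \int[M]_(v in punctured) (1 - cos '(v, u)) =
   - \int[M]_(v in punctured) (cos '(v, u) - 1).
  rewrite -[RHS]mulN1r -RintegralZl//; last 2 first.
  - exact: punctured_measurable.
  - exact: levy_cos_integrable.
  by apply: eq_Rintegral => v _; rewrite mulN1r opprB.
have c1 : 0 <= \int[M]_(v in punctured) (1 - cos '(v, u)).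
  by apply: Rintegral_ge0 => v _; rewrite subr_ge0 cos_le1.
have := D0 u; move: c0; set I := \int[M]_(v in _) (cos _ - 1) => c0 Du.
have I0 : I <= 0 by rewrite -oppr_ge0 -c0.
move=> /eqP DI.
have {}DI : \int[M]_(v in punctured) (1 - cos '(v, u)) = 0 by rewrite c0; lra.
have ic : M.-integrable punctured (fun v : borel V => (1 - cos '((v : V), u))%:E).
  rewrite (_ : (fun _ => _) = -%E \o (fun v : borel V => (cos '((v : V), u) - 1)%:E)).
    by apply: integrableN; exact: levy_cos_integrable.
  by apply/funext => v /=; rewrite opprB.
have : ae_eq M punctured (fun v : borel V => (1 - cos '((v : V), u))%:E) (cst 0%E).
  apply/(ae_eq_integral_abs M punctured_measurable (measurable_int _ ic)).
  under eq_integral do rewrite gee0_abs ?lee_fin ?subr_ge0 ?cos_le1//.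
  rewrite -[LHS]fineK; last exact: (integrable_fin_num punctured_measurable ic).
  by rewrite [X in X%:E]DI.
move=> H; apply: (@filterS _ _ (ae_filter_ringOfSetsType M) _ _ _ H) => v.
by move=> /[apply] -[] /eqP; rewrite subr_eq0 => /eqP <-.
Qed.

(** A single equation [cos '(v, y) = 1] only places ['(v, y)] in the multiples of 2 pi. Imposing it
    for all [y / (k + 1)], a countable family, forces ['(v, y) = 0]. *)
Lemma levy_measure_ssupp (D : 'End(V)) m (mu : probability (borel V) R) W h :
  is_levy_triple mu m D M -> mu (affine_subspace W h) = 1%E ->
  M (punctured `\` punctured_subspace W) = 0%E.
Proof.
move=> muE mu1.
have [e eW We] := exists_orthogonal_equations W.
have H i k : {ae M, forall v, punctured v -> cos '((v : V), k.+1%:R^-1 *: e`_i) = 1}.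
  case: (muE) => _ D0 _ _ _; apply: (@levy_re_eq0_ae D) => //.
  apply: (levy_re_eq0 muE mu1) => w wW; rewrite innerZr.
  (* Past the end of [e] the default value 0 of [nth] makes the claim trivial, so [i] may range over
     all naturals in [ae_foralln]. *)
  have [ie|ie] := ltnP i (size e); last by rewrite nth_default// inner0r mulr0.
  by rewrite innerC eW ?mulr0// mem_nth.
have : {ae M, forall v, punctured v -> (v : V) \in W}.
  have : {ae M, forall v i k, punctured v -> cos '((v : V), k.+1%:R^-1 *: e`_i) = 1}.
    by apply: ae_foralln => i; apply: ae_foralln => k; exact: H.
  apply: filterS; first exact: (ae_filter_ringOfSetsType M).
move=> v vH v0; apply: We => y ye.
  apply/eqP/negPn/negP => vy.
  have vy0 : 0 < `|'(v, y)| by rewrite normr_gt0.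
  (* With this [k] the quotient of [|'(v, y)|] by [k + 1] lies in []0, 1[], where its cosine cannot
     be 1. *)
  pose k := Num.truncn `|'(v, y)|.
  have := vH (index y e) k v0; rewrite nth_index// innerZr => c1.
  have : sin (`|'(v, y)| / k.+1%:R / 2) > 0.
    apply: sin2_gt0; rewrite !divr_gt0//= ltr_pdivrMr// ltr_pdivrMr//.
    have : `|'(v, y)| < k.+1%:R by exact: truncnS_gt.
    by have : 0 < k.+1%:R :> R by []; lra.
  have := one_sub_cosE (`|'(v, y)| / k.+1%:R).
  have -> : cos (`|'(v, y)| / k.+1%:R) = 1.
    transitivity (cos (k.+1%:R^-1 * '(v, y))); last exact: c1.
    rewrite -[RHS]cos_norm normrM mulrC; congr (cos (_ * _)).
    by rewrite ger0_norm.
  rewrite subrr => /esym/eqP; rewrite mulf_eq0 pnatr_eq0/= sqrf_eq0 => /eqP ->.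
  by rewrite ltxx.
case=> N [mN N0 NH]; apply/eqP; rewrite -measure_le0 -N0 le_measure ?inE//.
  exact: measurableD punctured_measurable (punctured_subspace_measurable W).
by move=> v [v0 vW]; apply: NH => /= /(_ v0) vW'; exact: vW.
Qed.

End LevyMeasure.

(** * Finite combinations of sines *)

Lemma Rintegral_lincomb d (T : measurableType d) (R : realType)
    (mu : {measure set T -> \bar R}) (D : set T) (I : Type) (s : seq I)
    (c : I -> R) (f : I -> T -> R) : measurable D ->
  (forall i, mu.-integrable D (EFin \o f i)) ->
  mu.-integrable D (fun x => (\sum_(i <- s) c i * f i x)%:E) /\
  \int[mu]_(x in D) (\sum_(i <- s) c i * f i x) =
  \sum_(i <- s) c i * \int[mu]_(x in D) f i x.
Proof.
move=> mD intf; elim: s => [|i s [IH1 IH2]].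
  split; first by under eq_fun do rewrite big_nil; exact: integrable0.
  by rewrite big_nil; under eq_Rintegral do rewrite big_nil; rewrite /Rintegral integral0.
have intcf : mu.-integrable D (fun x => (c i * f i x)%:E).
  exact: (integrableZl mD (c i) (intf i)).
split.
  by under eq_fun do rewrite big_cons EFinD; exact: integrableD.
rewrite big_cons -IH2 -RintegralZl// -RintegralD//.
by apply: eq_Rintegral => x _; rewrite big_cons.
Qed.

Section SineSums.
Context {R : realType} {V : innerProductSpaceType R}.
Implicit Types (F : V -> R) (s : seq (R * V)) (u v w z : V).

Definition sine_sum s v : R := \sum_(p <- s) p.1 * sin '(v, p.2).

Definition barycenter s : V := \sum_(p <- s) p.1 *: p.2.

(* F is the transform of a finitely supported signed measure with first
   moment z. *)
Definition sine_realizes F z :=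
  exists s, (forall v, sine_sum s v = F v) /\ barycenter s = z.

Lemma sine_realizes1 z : sine_realizes (fun v => sin '(v, z)) z.
Proof.
exists [:: (1, z)]; split=> [v|]; first by rewrite /sine_sum big_seq1 mul1r.
by rewrite /barycenter big_seq1 scale1r.
Qed.

Lemma sine_realizes_sum (I : Type) (r : seq I) (F : I -> V -> R) (z : I -> V) :
  (forall i, sine_realizes (F i) (z i)) ->
  sine_realizes (fun v => \sum_(i <- r) F i v) (\sum_(i <- r) z i).
Proof.
move=> H; elim: r => [|i r [s [sF sz]]].
  exists [::]; split=> [v|]; first by rewrite /sine_sum !big_nil.
  by rewrite /barycenter !big_nil.
have [s' [sF' sz']] := H i; exists (s' ++ s); split=> [v|].
  by rewrite /sine_sum big_cat big_cons -sF -sF'.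
by rewrite /barycenter big_cat big_cons -sz -sz'.
Qed.

Lemma sine_realizesZ (c : R) F z :
  sine_realizes F z -> sine_realizes (fun v => c * F v) (c *: z).
Proof.
move=> [s [sF sz]]; exists [seq (c * p.1, p.2) | p <- s]; split=> [v|].
  rewrite -sF /sine_sum big_map mulr_sumr; apply: eq_bigr => p _ /=; ring.
by rewrite -sz /barycenter big_map scaler_sumr; apply: eq_bigr => p _; rewrite scalerA.
Qed.

(** By the product formula, multiplying by [cos '(v, w)] splits every atom into two halves moved by
    [w] and [- w], which leaves the first moment unchanged. *)
Lemma sine_realizes_cos w F z :
  sine_realizes F z -> sine_realizes (fun v => cos '(v, w) * F v) z.
Proof.
move=> [s [sF sz]].
exists ([seq (p.1 / 2, p.2 + w) | p <- s] ++ [seq (p.1 / 2, p.2 - w) | p <- s]).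
split=> [v|].
  rewrite -sF /sine_sum big_cat !big_map/= -big_split mulr_sumr.
  by apply: eq_bigr => p _ /=; rewrite innerDr innerBr sinD sinB; field.
rewrite -sz /barycenter big_cat !big_map/= -big_split; apply: eq_bigr => p _ /=.
rewrite -scalerDr addrACA subrr addr0 -mulr2n -[p.2 *+ 2]scaler_nat scalerA.
by congr (_ *: _); field.
Qed.

Variables (n : nat) (w : 'I_n -> V).

(** One step of the Neumann series: the multiplier is a weighted sum of cosines of total mass
    [(walk_const n N - 1) / walk_const n N], and the first moment is scaled by that mass. *)
Lemma sine_realizes_walk N F z : sine_realizes F z ->
  sine_realizes (fun v => ((walk_const n N - 1 - walk_symbol N (fun j => '(v, w j)))
      / walk_const n N) * F v)
    (((walk_const n N - 1) / walk_const n N) *: z).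
Proof.
move=> Fz; have q0 : walk_const n N != 0 :> R.
  by rewrite gt_eqF// (lt_le_trans ltr01)// walk_const_ge1.
pose c : R := 2 * N.+1%:R ^+ 2 / walk_const n N.
have := @sine_realizes_sum 'I_n (index_enum 'I_n)
  (fun j v => c * (cos '(v, N.+1%:R^-1 *: w j) * F v)) (fun=> c *: z).
case=> [j|s [sF sz]]; first exact/sine_realizesZ/sine_realizes_cos.
exists s; split=> [v|].
  rewrite sF -mulr_sumr -mulr_suml mulrA; congr (_ * _).
  have -> : walk_const n N - 1 - walk_symbol N (fun j => '(v, w j)) =
     2 * N.+1%:R ^+ 2 * \sum_j cos '(v, N.+1%:R^-1 *: w j).
    rewrite /walk_symbol -mulr_sumr big_split/= sumr_const card_ord sumrN.
    under [in RHS]eq_bigr do rewrite innerZr mulrC.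
    by rewrite /walk_const natrM natrX; ring.
  by rewrite /c mulrAC.
rewrite sz sumr_const card_ord -scaler_nat scalerA; congr (_ *: _).
by rewrite /c /walk_const natrM natrX; field.
Qed.

(** Iterating [sine_realizes_walk] and summing gives the resolvent. Its first moment carries the
    same series evaluated at symbol 0. *)
Lemma sine_realizes_resolvent N (k : 'I_n) : sine_realizes
  (fun v => N.+1%:R * sin ('(v, w k) / N.+1%:R) *
     walk_resolvent n N (walk_symbol N (fun j => '(v, w j))))
  (walk_resolvent n N 0 *: w k).
Proof.
set F := fun v : V => N.+1%:R * sin ('(v, w k) / N.+1%:R).
have F1 : sine_realizes F (w k).
  have := sine_realizesZ N.+1%:R (sine_realizes1 (N.+1%:R^-1 *: w k)).
  rewrite scalerA mulfV ?pnatr_eq0// scale1r => -[s [sF sz]].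
  by exists s; split=> // v; rewrite sF /F innerZr mulrC [_^-1 * _]mulrC mulrC.
pose q : R := walk_const n N.
have Fi i : sine_realizes
    (fun v => ((q - 1 - walk_symbol N (fun j => '(v, w j))) / q) ^+ i * F v)
    (((q - 1) / q) ^+ i *: w k).
  elim: i => [|i /(@sine_realizes_walk N)[s [sF sz]]].
    by have [s [sF sz]] := F1; exists s; split=> [v|]; rewrite expr0 ?mul1r ?scale1r.
  exists s; split=> [v|]; first by rewrite sF exprS mulrA.
  by rewrite sz scalerA exprS.
have := @sine_realizes_sum 'I_(walk_length n N).+1 (index_enum _) _ _ (fun i => Fi i).
move=> /(sine_realizesZ q^-1)[s [sF sz]]; exists s; split=> [v|].
  rewrite sF -mulr_suml mulrA mulrC -/(F v); congr (_ * _).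
rewrite sz -scaler_suml scalerA; congr (_ *: _).
by rewrite /walk_resolvent /trunc_resolvent subr0.
Qed.

End SineSums.

(** * Operators on the supporting subspace *)

Section OperatorsOnSubspaces.
Context {R : realType} {V : innerProductSpaceType R} {W : {vspace V}}.
Implicit Types (S : 'End(V)) (T B : 'End(subvs_of W)) (v : V).

(** Extends [T] to [V] through a linear projection onto [W], which makes continuity and
    measurability on [V] available. *)
Definition ambient_lfun T : 'End(V) :=
  (linfun (@vsval _ _ W) \o T \o linfun (vsproj W))%VF.

Lemma ambient_lfunE T v : ambient_lfun T v = vsval (T (vsproj W v)).
Proof. by rewrite !comp_lfunE !lfunE. Qed.

Lemma ambient_lfun_lower_bound T : lker T == 0%VS ->
  exists2 A, 0 <= A & forall v, v \in W -> `|v| <= A * `|ambient_lfun T v|.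
Proof.
move=> T0; have [A A0 HA] := exists_linear_bound (ambient_lfun (T^-1)%VF).
exists A => // v vW; apply: le_trans (HA _).
by rewrite !ambient_lfunE vsvalK lker0_lfunK// vsprojK.
Qed.

(** With [B] the restriction of [S], the isometry [T B T^-1] maps [T v] to [T (S v)]. *)
Lemma symmetry_isometry T (G : set 'End(V)) S : lker T == 0%VS ->
  isometry_subgroup (conjugate_by T (restrictions W G)) -> G S ->
  (forall v, v \in W -> S v \in W) ->
  forall v, v \in W -> `|ambient_lfun T (S v)| = `|ambient_lfun T v|.
Proof.
move=> T0 [iso _ _ _] GS SW v vW.
pose B : 'End(subvs_of W) := (linfun (vsproj W) \o S \o linfun (@vsval _ _ W))%VF.
have BE w : vsval (B w) = S (vsval w).
  by rewrite !comp_lfunE !lfunE vsprojK// SW// subvsP.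
have /iso /(_ (T (vsproj W v))) : conjugate_by T (restrictions W G) (T \o B \o T^-1)%VF.
  by exists B => //; exists S.
rewrite !ambient_lfunE !comp_lfunE lker0_lfunK// => <-.
by congr (`|vsval (T _)|); rewrite !lfunE/= vsprojK.
Qed.

End OperatorsOnSubspaces.

(** * Invariance of the supporting subspace *)

Section InvariantSubspace.
Context {R : realType} {V : innerProductSpaceType R}.

(** The preimage of [W + h0] under the affine symmetry has mass 1 and is an affine subspace with
    direction [S @^-1: W]. By minimality it contains [W + h0]; compare the images of [v + h0] and
    [h0]. *)
Lemma symmetry_ssupp (mu : probability (borel V) R) (W : {vspace V}) (S : 'End(V)) h :
  is_ssupp mu W ->
  (forall E, measurable E -> mu E = mu (affine_map S h @^-1` E)) ->
  forall v, v \in W -> S v \in W.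
Proof.
move=> [h0 [mu1 minW]] muS.
have mA : measurable (affine_subspace W h0 : set (borel V)).
  exact: affine_subspace_measurable.
have AE (W' : {vspace V}) x v : affine_subspace W' x v = (v - x \in W') :> Prop.
  apply/propext; split; first by move=> [w /= wW <-]; rewrite addrK.
  by move=> vW; exists (v - x); rewrite ?subrK.
pose A : set V := affine_map S h @^-1` affine_subspace W h0.
have muA : mu A = 1%E by rewrite -mu1 [RHS]muS.
(* A base point for the preimage exists because a set of mass 1 is not empty. *)
have [v0 Av0] : exists v0, A v0.
  apply: contrapT => /forallNP A0; have : mu A = 0%E.
    by rewrite (_ : A = set0) ?measure0// -subset0 => v /(A0 v).
  by rewrite muA => /eqP; rewrite onee_eq0.
have AW : A = affine_subspace (S @^-1: W)%VS v0.
  apply/seteqP; split => v; rewrite /A /= !AE /affine_map -memv_preim linearB/=.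
    move=> vW; move: Av0; rewrite /A/= AE /affine_map => v0W.
    by have := memvB vW v0W; rewrite opprB addrA subrK opprD addrACA subrr addr0.
  move=> vW; move: Av0; rewrite /A/= AE /affine_map => v0W.
  by have := memvD vW v0W; rewrite -!addrA addKr.
have sub := minW (S @^-1: W)%VS v0; rewrite /concentrated_on -AW in sub.
have {}sub := sub muA => v vW.
have a1 : A (v + h0) by apply: sub; rewrite AE addrK.
have a0 : A h0 by apply: sub; rewrite AE subrr mem0v.
move: a1 a0; rewrite /A/= !AE /affine_map => a1 a0.
have := memvB a1 a0; rewrite linearD/= opprB addrA subrK opprD addrACA subrr addr0.
by rewrite addrK.
Qed.

End InvariantSubspace.

(** * The centring vector and its coordinates *)

Section CenterVector.
Context {R : realType} {V : innerProductSpaceType R} {W : {vspace V}}.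
Variables (M : {measure set (borel V) -> \bar R}) (T : 'End(subvs_of W)).
Hypothesis M_fin : (\int[M]_(v in punctured) (levy_weight v)%:E < +oo)%E.
Hypothesis T0 : lker T == 0%VS.
Implicit Types (u v y : V).

Definition center_density v : R :=
  (`|v| ^+ 2 - `|ambient_lfun T v| ^+ 2)
    / ((1 + `|ambient_lfun T v| ^+ 2) * (1 + `|v| ^+ 2)).

(** Identifies the density as the change from the standard truncation function to the one built from
    [T]. *)
Lemma center_densityE v : center_density v =
  (1 + `|ambient_lfun T v| ^+ 2)^-1 - (1 + `|v| ^+ 2)^-1.
Proof.
have t1 : 0 < 1 + `|ambient_lfun T v| ^+ 2 by rewrite ltr_wpDr ?exprn_ge0.
have v1 : 0 < 1 + `|v| ^+ 2 by rewrite ltr_wpDr ?exprn_ge0.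
by rewrite /center_density; field; rewrite !gt_eqF.
Qed.

Lemma inv_sqr_norm_continuous (S : 'End(V)) :
  continuous (fun v => (1 + `|S v| ^+ 2)^-1).
Proof.
move=> v; apply: cvgV; first by rewrite gt_eqF// ltr_wpDr ?exprn_ge0.
apply: cvgD; first exact: cvg_cst.
have c : `|S w| @[w --> v] --> `|S v| by apply: cvg_norm; exact: lfun_continuous.
by rewrite expr2; under eq_fun do rewrite expr2; apply: cvgM.
Qed.

Lemma center_density_continuous : continuous center_density.
Proof.
move=> v.
have -> : center_density = (fun v => (1 + `|ambient_lfun T v| ^+ 2)^-1 - (1 + `|v| ^+ 2)^-1).
  by apply/funext => w; rewrite center_densityE.
apply: cvgB; first exact: inv_sqr_norm_continuous.
have := @inv_sqr_norm_continuous \1%VF v; rewrite /continuous_at id_lfunE.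
by under eq_fun do rewrite id_lfunE.
Qed.

(** The difference of squares supplies the factor [|v| ^+ 2]. The lower bound of [T] on [W] lets
    [1 + |T v| ^+ 2] absorb the growth of ['(v, y)]. *)
Lemma center_density_bound y : exists C, forall v, v \in W ->
  `|center_density v * '(v, y)| <= C * levy_weight v.
Proof.
have [A A0 HA] := ambient_lfun_lower_bound T0.
have [B B0 HB] := exists_linear_bound (ambient_lfun T).
exists (`|y| * ((1 + B ^+ 2) * A)) => v vW.
have := HA _ vW; have := HB v; have := cauchy_schwarz v y.
rewrite /center_density /levy_weight.
move: (`|ambient_lfun T v|) (normr_ge0 (ambient_lfun T v)) => t t0.
move: (`|v|) (normr_ge0 v) (`|y|) (normr_ge0 y) => x x0 z z0.
move: '(v, y) => p px tB xA.
have t1 : 0 < 1 + t ^+ 2 by rewrite ltr_wpDr ?exprn_ge0.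
have x1 : 0 < 1 + x ^+ 2 by rewrite ltr_wpDr ?exprn_ge0.
rewrite invfM mulrA mulrAC [leRHS]mulrA normrM (gtr0_norm (x := (1 + x ^+ 2)^-1)) ?invr_gt0//.
rewrite ler_pM2r ?invr_gt0// mulrAC normrM (gtr0_norm (x := (1 + t ^+ 2)^-1)) ?invr_gt0//.
rewrite ler_pdivrMr// normrM.
have e1 : `|x ^+ 2 - t ^+ 2| <= (1 + B ^+ 2) * x ^+ 2.
  have : t ^+ 2 <= B ^+ 2 * x ^+ 2 by rewrite -exprMn lerXn2r ?nnegrE ?mulr_ge0.
  have : 0 <= t ^+ 2 by rewrite exprn_ge0.
  have : 0 <= x ^+ 2 by rewrite exprn_ge0.
  by move=> ? ? ?; rewrite ler_norml; apply/andP; split; nra.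
have e2 : `|p| <= z * A * (1 + t ^+ 2).
  apply: le_trans px _; rewrite mulrC -mulrA ler_wpM2l//.
  by apply: le_trans xA _; rewrite ler_wpM2l//; nra.
apply: le_trans (ler_pM _ _ e1 e2) _ => //.
by rewrite le_eqVlt; apply/orP; left; apply/eqP; ring.
Qed.

Let W0 := punctured_subspace W.

Lemma center_density_integrable y :
  M.-integrable W0 (fun v : borel V => (center_density v * '((v : V), y))%:E).
Proof.
have [C HC] := center_density_bound y.
apply: (levy_dominated_integrable (C := C) M_fin) => //.
- exact: punctured_subspace_measurable.
- exact: punctured_subspace_sub.
- apply: continuous_measurable_real => v; apply: cvgM.
    exact: center_density_continuous.
  exact: inner_continuous.
- by move=> v [vW _]; exact: HC.
Qed.

Definition center_integral : V := vintegral M W0 (fun v => center_density v *: v).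

Lemma center_vectorE m : center_vector T m M = - (m + center_integral).
Proof.
rewrite /center_vector /center_integral; congr (- (_ + _)); congr vintegral.
by apply/funext => v; rewrite /center_density ambient_lfunE.
Qed.

Lemma exists_riesz (f : {linear V -> R^o}) : exists z, forall v, f v = '(v, z).
Proof.
have [e _ He] := exists_orthonormal_expansion (@fullv _ V).
exists (\sum_(x <- e) f x *: x) => v.
rewrite {1}(He v (memvf v)) linear_sum inner_sumr; apply: eq_bigr => x _.
by rewrite linearZ innerZr mulrC.
Qed.

Lemma inner_center_integral y :
  '(center_integral, y) = \int[M]_(v in W0) (center_density v * '(v, y)).
Proof.
rewrite /center_integral /vintegral inner_suml.
set b := vbasis _.
(* Each coordinate functional is an inner product with a Riesz vector, so its integrability follows
   from [center_density_integrable]. *)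
have intc (i : 'I_(\dim {:V})) : M.-integrable W0
    (EFin \o (fun v : borel V => coord b i (center_density v *: (v : V)))).
  have [z Hz] := exists_riesz (coord b i).
  have := center_density_integrable z.
  by congr (M.-integrable _ _); apply/funext => v /=; rewrite linearZ/= Hz.
have [_] := Rintegral_lincomb (index_enum 'I_(\dim {:V})) (fun i => '(b`_i, y))
  (@punctured_subspace_measurable R V W) intc.
under eq_bigr do rewrite mulrC -innerZl.
move=> <-; apply: eq_Rintegral => v _.
rewrite -[in RHS]innerZl {2}(coord_vbasis (memvf (center_density v *: (v : V)))).
by rewrite inner_suml; apply: eq_bigr => i _; rewrite innerZl mulrC.
Qed.

End CenterVector.

(** * The centred measure *)

Section CenteredSymmetry.
Context {R : realType} {V : innerProductSpaceType R} {W : {vspace V}}.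
Variables (mu : probability (borel V) R) (m : V) (D : 'End(V)).
Variables (M : {measure set (borel V) -> \bar R}) (T : 'End(subvs_of W)).
Variables (h0 h : V) (S : 'End(V)).
Hypothesis muE : is_levy_triple mu m D M.
Hypothesis mu1 : mu (affine_subspace W h0) = 1%E.
Hypothesis T0 : lker T == 0%VS.
Hypothesis muS : forall E, measurable E -> mu E = mu (affine_map S h @^-1` E).
Hypothesis SW : forall v, v \in W -> S v \in W.
Hypothesis isoS :
  forall v, v \in W -> `|ambient_lfun T (S v)| = `|ambient_lfun T v|.
Implicit Types (u v y : V).

Let W0 := punctured_subspace W.
Let c := center_integral M T.
Let l := (m + c) - S (m + c) - h.
Let rho v : R := (1 + `|ambient_lfun T v| ^+ 2)^-1.

Let M_fin : (\int[M]_(v in punctured) (levy_weight v)%:E < +oo)%E.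
Proof. by case: muE. Qed.

Let mW0 : measurable W0. Proof. exact: punctured_subspace_measurable. Qed.

(* The Levy integrand recentred with the truncation function rho, which is
   invariant under S on W. *)
Definition recentred_sin u v : R := sin '(v, u) - '(v, u) * rho v.

Lemma recentred_sinE u v : recentred_sin u v =
  (sin '(v, u) - '(v, u) / (1 + `|v| ^+ 2)) - center_density T v * '(v, u).
Proof. by rewrite center_densityE /recentred_sin /rho; ring. Qed.

Lemma levy_sin_integrable_subspace u : M.-integrable W0
  (fun v : borel V => (sin '((v : V), u) - '((v : V), u) / (1 + `|v : V| ^+ 2))%:E).
Proof.
apply: (integrableS (@punctured_measurable R V) mW0) (levy_sin_integrable M_fin u).
exact: punctured_subspace_sub.
Qed.

Lemma recentred_sin_integrable u :
  M.-integrable W0 (EFin \o (recentred_sin u : borel V -> R)).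
Proof.
have -> : EFin \o (recentred_sin u : borel V -> R) =
  (fun v : borel V => (sin '((v : V), u) - '((v : V), u) / (1 + `|v : V| ^+ 2))%:E -
    (center_density T v * '((v : V), u))%:E)%E.
  by apply/funext => v /=; rewrite recentred_sinE.
apply: integrableB => //; first exact: levy_sin_integrable_subspace.
exact: center_density_integrable.
Qed.

(** The integral may be restricted to [W0] because [M] lives there; changing the truncation function
    then moves [c] into the drift. *)
Lemma levy_im_recentred u :
  levy_im m M u = '(m + c, u) + \int[M]_(v in W0) recentred_sin u v.
Proof.
have -> : \int[M]_(v in W0) recentred_sin u v =
    \int[M]_(v in W0) ((sin '(v, u) - '(v, u) / (1 + `|v| ^+ 2))
      - center_density T v * '(v, u)).
  by apply: eq_Rintegral => v _; rewrite recentred_sinE.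
rewrite RintegralB//; first last.
- exact: center_density_integrable.
- exact: levy_sin_integrable_subspace.
rewrite -inner_center_integral// -/c innerDl /levy_im.
rewrite (@Rintegral_setD_null _ _ _ _ punctured W0) //; first ring.
- exact: punctured_measurable.
- exact: punctured_subspace_sub.
- exact: levy_measure_ssupp muE mu1.
- exact: levy_sin_integrable.
Qed.

(** For [v] in [W], invariance of [rho] makes [recentred_sin u (S v)] equal to [recentred_sin u' v],
    where [u'] is the adjoint image of [u]. The identity is thus [levy_im_symmetry] in recentred
    form. *)
Lemma inner_discrepancy u :
  M.-integrable W0 (fun v : borel V => (recentred_sin u (S v) - recentred_sin u v)%:E) /\
  '(l, u) = \int[M]_(v in W0) (recentred_sin u (S v) - recentred_sin u v).
Proof.
have [u' uu'] := exists_adjoint S u.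
have E v : W0 v -> recentred_sin u (S v) = recentred_sin u' v.
  by move=> [vW _]; rewrite /recentred_sin /rho uu' isoS.
have iu := recentred_sin_integrable u; have iu' := recentred_sin_integrable u'.
split.
  apply: eq_integrable (integrableB mW0 iu' iu) => //.
  by move=> v /set_mem vW; rewrite /= E.
have -> : \int[M]_(v in W0) (recentred_sin u (S v) - recentred_sin u v) =
    \int[M]_(v in W0) (recentred_sin u' v - recentred_sin u v).
  by apply: eq_Rintegral => v /set_mem vW; rewrite E.
rewrite RintegralB//.
have := levy_im_symmetry M_fin muE muS uu'.
rewrite !levy_im_recentred -uu' /l !innerBl.
move=> H; rewrite -['(m + c, u)](addrK (\int[M]_(v in W0) recentred_sin u v)) H.
ring.
Qed.

(** For [y] orthogonal to [W] the integrand of [inner_discrepancy] vanishes, as [v] and [S v] both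
    lie in [W]. *)
Lemma discrepancy_in_subspace : l \in W.
Proof.
apply: orthogonal_orthogonal => y yW; have [_ ->] := inner_discrepancy y.
transitivity (\int[M]_(v in W0) (0 : R)); last by rewrite Rintegral_cst// mul0r.
apply: eq_Rintegral => v /set_mem[vW _]; rewrite /recentred_sin.
by rewrite innerC yW ?SW// innerC yW// sin0 !mul0r subrr.
Qed.

Lemma inner_discrepancy_barycenter (s : seq (R * V)) :
  let f v := (sine_sum s (S v) - '(S v, barycenter s) * rho (S v))
    - (sine_sum s v - '(v, barycenter s) * rho v) in
  M.-integrable W0 (fun v : borel V => (f v)%:E) /\
  '(l, barycenter s) = \int[M]_(v in W0) f v.
Proof.
move=> f.
have fE v : f v = \sum_(p <- s) p.1 * (recentred_sin p.2 (S v) - recentred_sin p.2 v).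
  rewrite /f /sine_sum /barycenter !inner_sumr !mulr_suml -!sumrB.
  by apply: eq_bigr => p _; rewrite !innerZr /recentred_sin; ring.
have [H1 H2] := Rintegral_lincomb s (fun p => p.1) mW0
  (fun p : R * V => (inner_discrepancy p.2).1).
split; first by under eq_fun do rewrite fE.
under eq_Rintegral do rewrite fE.
rewrite H2 /barycenter inner_sumr; apply: eq_bigr => p _.
by rewrite innerZr (inner_discrepancy p.2).2.
Qed.

(** * Vanishing of the discrepancy by dominated convergence *)

Section Orthogonality.
Variables (n : nat) (w : 'I_n -> V).
Hypothesis sqr_T : forall v, `|ambient_lfun T v| ^+ 2 = \sum_j '(v, w j) ^+ 2.

Let error k N v := walk_error k N (fun j => '(v, w j)).

Lemma inner_discrepancy_walk N k : exists f : V -> R,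
  [/\ M.-integrable W0 (fun v : borel V => (f v)%:E),
      forall v, W0 v -> f v = error k N (S v) - error k N v &
      walk_resolvent n N 0 * '(l, w k) = \int[M]_(v in W0) f v].
Proof.
have [s [sF sz]] := sine_realizes_resolvent w N k.
have [H1 H2] := inner_discrepancy_barycenter s.
eexists; split; [exact: H1| |by rewrite -H2 sz innerZr].
move=> v _ /=; rewrite !sF sz /error /walk_error !innerZr /rho !sqr_T.
ring.
Qed.

(** Converts the bound of [walk_error_bound], stated in terms of [|T v|], into one by the integrable
    [levy_weight]. *)
Lemma sqr_ratio_bound : exists2 C, 0 <= C &
  forall v, `|ambient_lfun T v| ^+ 2 / (1 + `|ambient_lfun T v| ^+ 2) <= C * levy_weight v.
Proof.
have [B B0 HB] := exists_linear_bound (ambient_lfun T).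
exists (1 + B ^+ 2) => [|v]; first by rewrite addr_ge0 ?exprn_ge0.
have := HB v; rewrite /levy_weight.
move: (`|ambient_lfun T v|) (normr_ge0 (ambient_lfun T v)) => t t0.
move: (`|v|) (normr_ge0 v) => x x0 tB.
have t1 : 0 < 1 + t ^+ 2 by rewrite ltr_wpDr ?exprn_ge0.
have x1 : 0 < 1 + x ^+ 2 by rewrite ltr_wpDr ?exprn_ge0.
rewrite mulrA ler_pdivrMr// mulrAC ler_pdivlMr//.
have : t ^+ 2 <= B ^+ 2 * x ^+ 2 by rewrite -exprMn lerXn2r ?nnegrE ?mulr_ge0.
have : 0 <= x ^+ 2 by rewrite exprn_ge0.
have : 0 <= t ^+ 2 by rewrite exprn_ge0.
have : 0 <= B ^+ 2 by rewrite exprn_ge0.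
move: (t ^+ 2) (x ^+ 2) (B ^+ 2) => a b e e0 a0 b0 ab.
have : 0 <= a * b by rewrite mulr_ge0.
have : 0 <= e * (a * b) by rewrite !mulr_ge0.
nra.
Qed.

Lemma inner_discrepancy_eq0 k : '(l, w k) = 0.
Proof.
have [C C0 HC] := sqr_ratio_bound.
have [f /all_and3[fint fE fI]] := choice (fun N => inner_discrepancy_walk N k).
have cvgI : (\int[M]_(v in W0) (f N v)%:E)%E @[N --> \oo] --> (\int[M]_(v in W0) (0 : R)%:E)%E.
  (* The constant 40 counts 20 for the error at [S v] and 20 for the error at [v]; both are
     controlled at [v] because [|T (S v)| = |T v|]. *)
  apply: (dominated_cvg mW0 (g := fun v : borel V => (40 * C * levy_weight v)%:E)).
  - by move=> N; exact: measurable_int (fint N).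
  - move=> v vW; apply: cvg_EFin; first exact: nearW.
    under eq_fun do rewrite fE//.
    have := cvgB (@walk_error_cvg R n k (fun j => '(S v, w j)))
      (@walk_error_cvg R n k (fun j => '(v, w j))).
    by rewrite subrr; exact.
  - by [].
  - apply: (integrableZl mW0 (40 * C) (f := fun v : borel V => (levy_weight v)%:E)).
    apply: (integrableS (@punctured_measurable R V) mW0) (levy_weight_integrable M_fin).
    exact: punctured_subspace_sub.
  - move=> N v vW; rewrite /= lee_fin fE//.
    have E v' : `|ambient_lfun T v'| = `|ambient_lfun T v| ->
        `|error k N v'| <= 20 * (C * levy_weight v).
      move=> Tv; apply: le_trans (walk_error_bound _ _ _) _.
      by rewrite ler_wpM2l// -sqr_T Tv.
    apply: le_trans (ler_normB _ _) _.
    apply: le_trans (lerD (E _ (isoS vW.1)) (E _ erefl)) _.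
    by rewrite le_eqVlt; apply/orP; left; apply/eqP; ring.
have {}cvgI : walk_resolvent n N 0 * '(l, w k) @[N --> \oo] --> (0 : R).
  under eq_fun do rewrite fI; apply: fine_cvg.
  by move: cvgI; rewrite integral0; exact.
have cvg1 : walk_resolvent n N 0 * '(l, w k) @[N --> \oo] --> 1 * '(l, w k).
  by apply: cvgM; [exact: walk_resolvent0_cvg|exact: cvg_cst].
rewrite -[LHS]mul1r; apply: (cvg_unique _ cvg1 cvgI).
exact: norm_hausdorff.
Qed.

End Orthogonality.

(** Taking for [w] the adjoint images of an orthonormal basis, the vanishing of all ['(l, w k)]
    means [T l = 0]. As [l] lies in [W], injectivity of [T] concludes. *)
Lemma discrepancy_eq0 : l = 0.
Proof.
have [e _ He] := exists_orthonormal_expansion (@fullv _ V).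
have /choice[w Hw] : forall i : 'I_(size e), exists z, forall v,
    '(ambient_lfun T v, e`_i) = '(v, z) by move=> i; exact: exists_adjoint.
have sqr_T v : `|ambient_lfun T v| ^+ 2 = \sum_j '(v, w j) ^+ 2.
  rewrite (sqr_norm_expansion (He _ (memvf _))) (big_nth 0) big_mkord.
  by apply: eq_bigr => i _; rewrite Hw.
have [A _ HA] := ambient_lfun_lower_bound T0.
have Tl : ambient_lfun T l = 0.
  apply/eqP; rewrite -normr_eq0 -sqrf_eq0 sqr_T big1// => k _.
  by rewrite inner_discrepancy_eq0// expr0n.
have := HA _ discrepancy_in_subspace; rewrite Tl normr0 mulr0.
by rewrite normr_le0 => /eqP.
Qed.

Lemma symmetry_translationE : h = (m + c) - S (m + c).
Proof. by apply/esym/eqP; rewrite -subr_eq0; apply/eqP; exact: discrepancy_eq0. Qed.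

End CenteredSymmetry.

Theorem mainTheorem2 (R : realType) (V : innerProductSpaceType R)
    (mu : probability (borel V) R) (m : V) (D : 'End(V))
    (M : {measure set (borel V) -> \bar R})
    (mu_mDM : is_levy_triple mu m D M)
    (W : {vspace V}) (muW : is_ssupp mu W)
    (T : 'End(subvs_of W)) (T_inv : lker T == 0%VS)
    (T_conj : isometry_subgroup (conjugate_by T (restrictions W (symmetries mu)))) :
  let h' := center_vector T m M in
  forall S : 'End(V), S \in symmetries mu ->
    same_measure (convolution mu (point_mass h'))
               (image_measure S (convolution mu (point_mass h'))).
Proof.
move=> h' S /set_mem symS E mE.
have /is_symmetryP[h muS] : is_symmetry mu S by [].
have SW := symmetry_ssupp muW muS.
have [h0 [mu1 _]] := muW.
have hE := symmetry_translationE mu_mDM mu1 T_inv muS SW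
  (symmetry_isometry T_inv T_conj symS SW).
have mSE : measurable ((S : borel V -> borel V) @^-1` E).
  by rewrite -[X in measurable X]setTI; exact: lfun_measurable.
rewrite /image_measure /pushforward !convolution_point_mass//.
rewrite muS; last exact: measurable_affine_preimage.
have hh' : h + h' = S h'.
  by rewrite /h' center_vectorE hE linearN/= addrAC subrr sub0r.
(* The two events are the preimages of [E] under [v -> S v + h + h'] and [v -> S (v + h')]. *)
congr (mu _); apply/seteqP; split => v /=;
by rewrite !affine_map_idE /affine_map linearD/= -hh' addrA.
Qed.
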